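(* If $f$ is a bell-shaped (or a weakly bell-shaped) function, then there are constants $p, q$ such that for every $n = 1, 2, \ldots$ all zeroes of $f^{(n)}$ are contained in $[p n, q n]$.
   Context: A smooth function $f : \mathbb{R} \to [0, \infty)$ is bell-shaped (or strictly bell-shaped) if $f(x) \to 0$ as $x \to \pm\infty$ and for every $n = 0, 1, 2, \ldots$ the $n$-th derivative $f^{(n)}$ changes its sign exactly $n$ times. Let $G_t(x) = (4 \pi t)^{-1/2} e^{-x^2/(4t)}$. A weakly bell-shaped function is a non-negative measure $f$ on $\mathbb{R}$ such that for every $t > 0$ the convolution of $f$ with $G_t$ is strictly bell-shaped. Every weakly bell-shaped function is absolutely continuous with respect to the Lebesgue measure, except possibly for an atom of non-negative mass at a single point, and its density function is denoted by the same symbol $f$. By a zero of the derivative $f^{(n)}$ we always understand a point at which $f^{(n)}$ changes its sign. *)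

(* Defs.v *)
From HB Require Import structures.
From mathcomp Require Import all_boot all_order all_algebra.
From mathcomp Require Import all_classical all_reals all_analysis.
Set Implicit Arguments.
Unset Strict Implicit.
Unset Printing Implicit Defensive.
Import Order.TTheory GRing.Theory Num.Theory.
Import numFieldNormedType.Exports.
Local Open Scope classical_set_scope.
Local Open Scope ring_scope.

Definition smooth (R : realType) (f : R -> R) : Prop :=
  forall (n : nat) (x : R), derivable (derive1n n f) x 1.

(* [g] takes nonzero values of alternating signs at some n + 1 points
   x_0 < ... < x_n. *)
Definition has_sign_changes (R : realType) (g : R -> R) (n : nat) : Prop :=
  exists s : seq R,
    [/\ size s = n.+1, sorted <%R s & sorted (fun y z => g y * g z < 0) s].

Definition changes_sign_exactly (R : realType) (g : R -> R) (n : nat) : Prop :=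
  has_sign_changes g n /\ ~ has_sign_changes g n.+1.

Definition bell_shaped (R : realType) (f : R -> R) : Prop :=
  [/\ smooth f,
      forall x, 0 <= f x,
      f x @[x --> -oo] --> 0,
      f x @[x --> +oo] --> 0 &
      forall n, changes_sign_exactly (derive1n n f) n].

Definition gauss_kernel (R : realType) (t x : R) : R :=
  (Num.sqrt (4 * pi * t))^-1 * expR (- (x ^+ 2 / (4 * t))).

Definition gauss_conv (R : realType)
    (mu : {measure set (measurableTypeR R) -> \bar R}) (t x : R) : \bar R :=
  (\int[mu]_y (gauss_kernel t (x - y))%:E)%E.

(* The integral defining the convolution is nonnegative but may be +oo, where
   [fine] returns 0: finiteness is part of the convolution being bell-shaped. *)
Definition weakly_bell_shaped (R : realType)
    (mu : {measure set (measurableTypeR R) -> \bar R}) : Prop :=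
  forall t : R, 0 < t ->
    (forall x, gauss_conv mu t x < +oo)%E /\
    bell_shaped (fun x => fine (gauss_conv mu t x)).

(* When [g] has finitely many sign changes, this says that [g] has opposite
   signs on the two sides of [x]. *)
Definition changes_sign_at (R : realType) (g : R -> R) (x : R) : Prop :=
  forall U : set R, nbhs x U -> exists y z, [/\ U y, U z, g y < 0 & 0 < g z].

Definition test_function (R : realType) (U : set R) (phi : R -> R) : Prop :=
  [/\ smooth phi,
      compact (closure [set x | phi x != 0]) &
      closure [set x | phi x != 0] `<=` U].

(* A weakly bell-shaped measure need not have a smooth density (it may have an
   atom, and the density may be singular or jump), so its n-th derivative is
   taken in the sense of distributions. *)
Definition distr_derive (R : realType)
    (mu : {measure set (measurableTypeR R) -> \bar R}) (n : nat)
    (phi : R -> R) : R :=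
  (-1) ^+ n * \int[mu]_y (derive1n n phi y).

(* The analogue of [changes_sign_at] for distributions: [T] is neither a
   nonnegative nor a nonpositive distribution in any neighbourhood of [x]. *)
Definition distr_changes_sign_at (R : realType) (T : (R -> R) -> R) (x : R) :
    Prop :=
  forall U : set R, nbhs x U ->
    exists phi psi : R -> R,
      [/\ test_function U phi /\ (forall y, 0 <= phi y),
          test_function U psi /\ (forall y, 0 <= psi y),
          T phi < 0 & 0 < T psi].

(* Main.v *)
(** Let [f] be bell-shaped with mode [c], let [b_1, ..., b_d] ([d <= n]) be the
    zeroes of [f^(n)] and [P(x) = (b_1 - x) ... (b_d - x)], so that [f^(n) P] has
    constant sign.  As [deg P <= n], integration by parts annihilates polynomials
    and gives, for [z = c + i u],
      [int f^(n)(x) P(x) / (x - z) dx = (n-1)! P(z) int f'(x) (x - z)^-n dx].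
    The left-hand integrand has constant sign up to the Cauchy kernel, so the left
    sides at [u_1 < u_2] are comparable up to the factor [u_2 / u_1].  If some
    [|b_j - c| >= u_2], this factor is absorbed by [P(c + i u_2) / P(c + i u_1)],
    whose [j]-th factor is at most 2 in modulus.  With [u = n / t], one side of
      [I(t) = int f'(x) (1 + i (x - c) t / n)^-n dx]
    is then controlled for all [t >= t_2] by its size at [t_2 = n / u_2]; and
    [I(t) = O(t)] for [t <= t_2], by one more integration by parts.  But [f'] and
    [x - c] have opposite signs, whence the average of the imaginary part of [I]
    over a fixed interval of [t] is bounded away from 0.  So for small [t_2] all
    zeroes satisfy [|b_j - c| < n / t_2].

    The constants depend on [f] only through its mass near 0 and its decay, so
    they are uniform over the convolutions [mu * G_t], [0 < t <= t_0], and the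
    bound passes to the limit [t -> 0] after testing against test functions. *)

Require Import Defs.
From HB Require Import structures.
From mathcomp Require Import all_boot all_order all_algebra.
From mathcomp Require Import all_classical all_reals all_analysis.
From mathcomp Require Import measurable_realfun ring lra.
Import Order.TTheory GRing.Theory Num.Theory.
Import numFieldNormedType.Exports.
From mathcomp Require Import complex.
Import ComplexField.Normc.
Local Open Scope classical_set_scope.
Local Open Scope ring_scope.
Set Implicit Arguments.
Unset Strict Implicit.
Unset Printing Implicit Defensive.

(** * Integrals of continuous functions on segments *)

(** The decay [r^n f^(n)(c +- r) -> 0] removes boundary terms, but it does not by itself make the
    integrals over the line absolutely convergent, and [f] need not be integrable. So no improper
    integral is formed: an identity says that a difference of integrals over [[c - r, c + r]] tends
    to 0 as [r] grows, and inequalities are transferred at a finite [r] with a small error.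

    Count of powers: passing from the height [u_2] down to [u_1] costs [u_2 / u_1] for the kernel
    and at most [(u_2 / u_1)^d] for [P], while the normalisation by [u^n] in [I] gives back
    [(u_1 / u_2)^n]. As [d <= n], at most one factor [u_2 / u_1] is left over, and a single zero far
    from [c] removes it at the price of a factor 2. This is where the number of sign changes enters.

    Gaussian smoothing only controls integrals of [mu * G_t] against Lipschitz functions of compact
    support. The hypotheses on a family are therefore stated with integrals over intervals, and
    unimodality turns them into pointwise bounds. *)

Definition rint (R : realType) (a b : R) (h : R -> R) : R :=
  \int[@lebesgue_measure R]_(x in `[a, b]) h x.

Section Calculus.
Variable R : realType.
Implicit Types (a b c : R) (f g h F G : R -> R).

Lemma is_derive_continuous F f : (forall x, is_derive x (1 : R) F (f x)) -> continuous F.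
Proof.
move=> dF x; apply/differentiable_continuous/derivable1_diffP.
by have [] := dF x.
Qed.

Lemma continuous_add f g : continuous f -> continuous g ->
  continuous (fun x => f x + g x).
Proof. by move=> cf cg x; apply: cvgD; [exact: cf|exact: cg]. Qed.

Lemma continuous_sub f g : continuous f -> continuous g ->
  continuous (fun x => f x - g x).
Proof. by move=> cf cg x; apply: cvgB; [exact: cf|exact: cg]. Qed.

Lemma continuous_mul f g : continuous f -> continuous g ->
  continuous (fun x => f x * g x).
Proof. by move=> cf cg x; apply: cvgM; [exact: cf|exact: cg]. Qed.

Lemma continuous_scale k f : continuous f -> continuous (fun x => k * f x).
Proof. by move=> cf; apply: continuous_mul => // x; exact: cvg_cst. Qed.

Lemma is_derive_mul f g x df dg :
  is_derive x (1 : R) f df -> is_derive x (1 : R) g dg ->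
  is_derive x (1 : R) (fun x => f x * g x) (df * g x + f x * dg).
Proof.
move=> Hf Hg; refine (is_derive_eq (is_deriveM Hf Hg) _).
by rewrite addrC; congr (_ + _); rewrite /GRing.scale/= mulrC.
Qed.

Lemma is_derive_add f g x df dg :
  is_derive x (1 : R) f df -> is_derive x (1 : R) g dg ->
  is_derive x (1 : R) (fun x => f x + g x) (df + dg).
Proof. by move=> Hf Hg; exact: is_deriveD. Qed.

Lemma is_derive_sub f g x df dg :
  is_derive x (1 : R) f df -> is_derive x (1 : R) g dg ->
  is_derive x (1 : R) (fun x => f x - g x) (df - dg).
Proof. by move=> Hf Hg; exact: is_deriveB. Qed.

Lemma is_derive_scale k f x df : is_derive x (1 : R) f df ->
  is_derive x (1 : R) (fun x => k * f x) (k * df).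
Proof. by move=> Hf; exact: is_deriveZ. Qed.

Lemma is_derive_affine f (k m x df : R) : is_derive (k * x + m) (1 : R) f df ->
  is_derive x (1 : R) (fun x => f (k * x + m)) (k * df).
Proof.
move=> Hf; have H : is_derive x (1 : R) (fun x => k * x + m) k.
  have := is_derive_add (is_derive_scale k (is_derive_id x 1))
    (is_derive_cst m x 1).
  by rewrite mulr1 addr0.
by rewrite [k * df]mulrC; exact: (@is_derive1_comp R f (fun x => k * x + m) x df k Hf H).
Qed.

Lemma is_derive_shift f (c x df : R) : is_derive (x - c) (1 : R) f df ->
  is_derive x (1 : R) (fun x => f (x - c)) df.
Proof.
move=> H; rewrite (_ : (fun x => _) = (fun x => f (1 * x + - c))); last first.
  by apply/funext => y; rewrite mul1r.
by rewrite -[df]mul1r; apply: is_derive_affine; rewrite mul1r.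
Qed.

Lemma rint_integrable a b h : continuous h ->
  (@lebesgue_measure R).-integrable `[a, b] (EFin \o h).
Proof.
move=> ch; apply: continuous_compact_integrable; first exact: segment_compact.
exact: continuous_subspaceT.
Qed.

Lemma rint_FTC F f a b : a <= b -> continuous f ->
  (forall x, is_derive x (1 : R) F (f x)) -> rint a b f = F b - F a.
Proof.
move=> ab cf dF; have cF := is_derive_continuous dF.
move: ab; rewrite le_eqVlt => /predU1P[->|ab].
  by rewrite /rint set_itv1 Rintegral_set1 subrr.
rewrite /rint /Rintegral (@continuous_FTC2 R f F)//.
- exact: continuous_subspaceT.
- split.
  + by move=> x _; have [] := dF x.
  + by apply: cvg_at_right_filter; exact: cF.
  + by apply: cvg_at_left_filter; exact: cF.
- by move=> x _; rewrite derive1E; apply: derive_val.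
Qed.

Lemma rintD a b f g : continuous f -> continuous g ->
  rint a b (fun x => f x + g x) = rint a b f + rint a b g.
Proof. by move=> cf cg; rewrite /rint RintegralD//; exact: rint_integrable. Qed.

Lemma rintZ a b k f : continuous f ->
  rint a b (fun x => k * f x) = k * rint a b f.
Proof. by move=> cf; rewrite /rint RintegralZl//; exact: rint_integrable. Qed.

Lemma rint_le a b f g : continuous f -> continuous g ->
  (forall x, a <= x <= b -> f x <= g x) -> rint a b f <= rint a b g.
Proof.
move=> cf cg fg; rewrite /rint le_Rintegral//; exact: rint_integrable.
Qed.

Lemma rint_ge0 a b f : (forall x, a <= x <= b -> 0 <= f x) -> 0 <= rint a b f.
Proof. by move=> f0; apply: Rintegral_ge0 => x /=; rewrite in_itv/= => /f0. Qed.

Lemma rint_abs a b f g : continuous f -> continuous g ->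
  (forall x, a <= x <= b -> `|f x| <= g x) -> `|rint a b f| <= rint a b g.
Proof.
move=> cf cg fg; rewrite /rint.
apply: (le_trans (le_normr_Rintegral _ (rint_integrable a b cf))) => //.
by apply: rint_le => // x; apply: cvg_norm; exact: cf.
Qed.

Lemma rint_cst a b k : a <= b -> rint a b (fun=> k) = k * (b - a).
Proof.
move=> ab; rewrite /rint Rintegral_cst//= lebesgue_measure_itv/= lte_fin.
by case: ltP => //= ba; rewrite (le_anti (introT andP (conj ab ba))) subrr.
Qed.

Lemma rint_split a b c f : continuous f -> a <= b -> b <= c ->
  rint a c f = rint a b f + rint b c f.
Proof.
move=> cf ab bc; have := @Rintegral_itvB R f (BLeft a) (BRight c) b.
move=> /(_ (rint_integrable a c cf)); rewrite !bnd_simp => /(_ ab bc) E.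
rewrite /rint -(@Rintegral_itv_obnd_cbnd _ b (BRight c)); last first.
  apply: integrableS (rint_integrable b c cf) => //.
  by apply: subset_itvr; rewrite bnd_simp.
by rewrite -E addrC subrK.
Qed.

Lemma rint_sub a a' b b' f : continuous f -> (forall x, 0 <= f x) ->
  a' <= a -> a <= b -> b <= b' -> rint a b f <= rint a' b' f.
Proof.
move=> cf f0 aa ab bb; rewrite (@rint_split a' a b')// ?(le_trans ab)//.
rewrite (@rint_split a b b')// addrCA lerDl.
by rewrite addr_ge0// rint_ge0.
Qed.

Lemma rint_by_parts F G f g a b : a <= b -> continuous f -> continuous g ->
  (forall x, is_derive x (1 : R) F (f x)) -> (forall x, is_derive x (1 : R) G (g x)) ->
  rint a b (fun x => f x * G x) =
    F b * G b - F a * G a - rint a b (fun x => F x * g x).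
Proof.
move=> ab cf cg dF dG.
have cF := is_derive_continuous dF; have cG := is_derive_continuous dG.
have cfG : continuous (fun x => f x * G x) by exact: continuous_mul.
have cFg : continuous (fun x => F x * g x) by exact: continuous_mul.
have <- := rint_FTC ab _ (fun x => is_derive_mul (dF x) (dG x)).
  by rewrite rintD// addrK.
exact: continuous_add.
Qed.

End Calculus.

(** * Sign changes *)

Section SignChanges.
Variable R : realType.
Implicit Types (f g h : R -> R) (s : seq R).

(** Induction on [n], splitting off the leftmost root [a], the infimum of the set where [g > 0]. An
    alternation of [- g] inside [(a, +oo)] that starts with a positive value can be prolonged to the
    left by a point where [g > 0], so [- g] cut off to [(a, +oo)] satisfies the hypothesis with one
    point less. *)
Lemma alternation_roots (n : nat) : forall g,
  (exists m, forall x, 0 < g x -> m <= x) ->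
  (forall s, size s = n.+1 -> sorted <%R s ->
     sorted (fun y z => g y * g z < 0) s -> ~ 0 < g (head 0 s)) ->
  exists s, (size s <= n)%N /\ forall x, g x * \prod_(b <- s) (b - x) <= 0.
Proof.
elim: n => [|n IHn] g [m gm] galt.
  exists [::]; split => // x; rewrite big_nil mulr1 leNgt.
  by apply/negP; exact: (galt [:: x]).
have [g0|] := pselect (forall x, g x <= 0).
  by exists [::]; split => // x; rewrite big_nil mulr1.
move=> /existsNP[x1 /negP]; rewrite -ltNge => gx1.
pose A := [set x | 0 < g x]; pose a := inf A.
have hA : has_inf A by split; [exists x1|exists m => x /gm].
have [s [ss hs]] : exists s, (size s <= n)%N /\
    forall x, (if a < x then - g x else 0) * \prod_(b <- s) (b - x) <= 0.
  apply: IHn.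
    by exists a => x; case: (ltP a x) => [/ltW//|_]; rewrite ltxx.
  case=> // y0 s [ss] slt salt /=.
  case: (ltP a y0) => [ay0 gy0|_]; last by rewrite ltxx.
  have [x gx xy0] := inf_lt hA.1 ay0.
  rewrite oppr_gt0 in gy0.
  apply: (galt (x :: y0 :: s)) => //=; [by rewrite ss|by rewrite xy0|].
  rewrite pmulr_rlt0 ?gy0//=; apply: (sub_path _ salt) => u v /=.
  by case: (ltP a u) => _; [case: (ltP a v) => _|];
    rewrite ?mulrNN ?mulr0 ?mul0r ?ltxx.
(* Roots below [a] are moved to [a]: for [x > a] this multiplies the product by a positive number,
   and for [x < a] it makes every factor positive. *)
exists (a :: map (Num.max a) s); split; first by rewrite /= size_map.
move=> x; rewrite big_cons big_map.
have [xa|ax|->] := ltgtP x a; last by rewrite subrr mul0r mulr0.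
- apply: mulr_le0_ge0; last first.
    rewrite mulr_ge0 ?subr_ge0 ?(ltW xa)//.
    by apply: prodr_ge0 => b _; rewrite subr_ge0 le_max (ltW xa).
  rewrite leNgt; apply/negP => gx; move: xa; rewrite ltNge => /negP; apply.
  exact: ge_inf hA.2 _ gx.
- have [t t0 ->] : exists2 t, 0 <= t &
      \prod_(b <- s) (Num.max a b - x) = t * \prod_(b <- s) (b - x).
    elim: {ss hs} s => [|b s [t t0 IH]].
      by exists 1 => //; rewrite !big_nil mulr1.
    rewrite !big_cons IH; have [ab|ba] := leP a b.
      by exists t => //; rewrite mulrCA.
    exists ((a - x) / (b - x) * t).
      by rewrite mulr_ge0// mulr_le0 ?invr_le0 ?subr_le0 ?ltW// (lt_trans ba).
    have bx : b - x != 0 by rewrite subr_eq0 lt_eqF// (lt_trans ba).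
    by field.
  have := hs x; rewrite ax mulNr oppr_le0 => h.
  rewrite (_ : _ * _ = (a - x) * (t * (g x * \prod_(b <- s) (b - x)))); last by ring.
  by rewrite nmulr_rle0 ?subr_lt0// mulr_ge0.
Qed.

(** The given alternation is of maximal length. Hence to the left of its first point [x0] the
    function never has the sign opposite to [g x0], or it could be prolonged. For the same reason no
    alternation of this length starts with that opposite sign: the leftmost of the two first points
    would prolong the other alternation. *)
Lemma changes_sign_exactly_roots g (n : nat) : changes_sign_exactly g n.+1 ->
  exists s (sg : R), [/\ (size s <= n.+1)%N, sg = 1 \/ sg = -1 &
    forall x, 0 <= sg * g x * \prod_(b <- s) (b - x)].
Proof.
move=> [[s0 [ss0 slt salt]] gn].
case: s0 ss0 slt salt => // x0 [|x1 s0]// [ss0] slt salt.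
have ext y s : size s = n.+2 -> y < head 0 s -> g y * g (head 0 s) < 0 ->
    sorted <%R s -> ~ sorted (fun y z => g y * g z < 0) s.
  case: s => // z s ss yz gyz sl sa; apply: gn; exists (y :: z :: s).
  by split; [rewrite /= -ss|apply/andP|apply/andP].
have [sg [sgE gx0]] : exists sg : R, (sg = 1 \/ sg = -1) /\ 0 < sg * g x0.
  have : g x0 != 0 by move: salt => /= /andP[+ _]; apply: contraTneq => ->; rewrite mul0r ltxx.
  rewrite neq_lt => /orP[gx|gx]; [exists (-1)|exists 1].
    by split; [right|rewrite mulN1r oppr_gt0].
  by split; [left|rewrite mul1r].
have sgM u v : (- sg * g u) * (- sg * g v) = g u * g v.
  by case: sgE => ->; ring.
have sgM' u v : 0 < - sg * g u -> 0 < sg * g v -> g u * g v < 0.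
  case: sgE => -> hu hv; nra.
have [|s ss salts|s [ss hs]] := @alternation_roots n.+1 (fun x => - sg * g x).
- exists x0 => x gx; rewrite leNgt; apply/negP => xx0.
  by apply: (ext x (x0 :: x1 :: s0)) => //=; [rewrite ss0|exact: sgM'].
- move=> alt gs.
  have {}alt : sorted (fun y z => g y * g z < 0) s.
    by apply: sub_sorted alt => u v /=; rewrite sgM.
  have [lt|gt|e] := ltgtP x0 (head 0 s).
  + by apply: (ext x0 s) => //; rewrite mulrC; exact: sgM'.
  + apply: (ext (head 0 s) (x0 :: x1 :: s0)) => //=; [by rewrite ss0|exact: sgM'].
  + by move: gs gx0; rewrite -e mulNr oppr_gt0 => /ltW; rewrite leNgt => /negP.
- exists s, sg; split => // x; have := hs x.
  by rewrite -mulrA mulNr mulNr oppr_le0 mulrA.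
Qed.

Lemma roots_const_sign_right g s (sg B : R) : sg = 1 \/ sg = -1 ->
  (forall x, 0 <= sg * g x * \prod_(b <- s) (b - x)) ->
  (forall b, b \in s -> b <= B) ->
  (forall x, B < x -> 0 <= g x) \/ (forall x, B < x -> g x <= 0).
Proof.
move=> sgE gs sB.
have [e [eE he]] : exists e : R, (e = 1 \/ e = -1) /\
    forall x, B < x -> 0 < e * \prod_(b <- s) (b - x).
  elim: s sB {gs} => [|b s IH] sB.
    by exists 1; split; [left|move=> x _; rewrite big_nil mulr1].
  have [b' b's|e [eE he]] := IH; first by apply: sB; rewrite inE b's orbT.
  exists (- e); split; first by case: eE => ->; [right|left; rewrite opprK].
  move=> x Bx; rewrite big_cons.
  rewrite (_ : _ * _ = (x - b) * (e * \prod_(j <- s) (j - x))); last by ring.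
  by rewrite mulr_gt0 ?he// subr_gt0 (le_lt_trans _ Bx)// sB// inE eqxx.
have : forall x, B < x -> 0 <= sg * e * g x.
  move=> x Bx; have := he x Bx; set p := \prod_(b <- s) _ => ep.
  rewrite -(pmulr_lge0 _ ep).
  have -> : sg * e * g x * (e * p) = (e * e) * (sg * g x * p) by ring.
  by rewrite mulr_ge0 ?gs// -expr2 sqr_ge0.
case: sgE => ->; case: eE => -> H; [left|right|right|left] => x /H; lra.
Qed.

Lemma roots_const_sign_left g s (sg B : R) : sg = 1 \/ sg = -1 ->
  (forall x, 0 <= sg * g x * \prod_(b <- s) (b - x)) ->
  (forall b, b \in s -> B <= b) ->
  (forall x, x < B -> 0 <= g x) \/ (forall x, x < B -> g x <= 0).
Proof.
move=> sgE gs sB.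
have : forall x, x < B -> 0 <= sg * g x.
  move=> x Bx; have h := gs x.
  rewrite -(pmulr_lge0 _ (_ : 0 < \prod_(b <- s) (b - x)))//.
  rewrite big_seq_cond; apply: prodr_gt0 => b; rewrite andbT => bs.
  by rewrite subr_gt0 (lt_le_trans Bx)// sB.
by case: sgE => -> H; [left|right] => x /H; lra.
Qed.

Lemma seq_bound s : exists2 B : R, 0 <= B & forall b, b \in s -> `|b| <= B.
Proof.
elim: s => [|b s [B B0 IH]]; first by exists 0.
exists (`|b| + B); first by rewrite addr_ge0.
move=> x; rewrite inE => /predU1P[->|/IH xB]; first by rewrite lerDl.
by rewrite (le_trans xB)// lerDr.
Qed.

End SignChanges.

(** * Decay of the derivatives of a bell-shaped function *)

Section Decay.
Variable R : realType.
Implicit Types (f g h : R -> R).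

Definition vanishes h :=
  forall e : R, 0 < e -> exists B : R, forall x : R, B <= x -> `|h x| <= e.

Lemma vanishes_eq g h : (forall x, g x = h x) -> vanishes g -> vanishes h.
Proof. by move=> gh vg e e0; have [B hB] := vg e e0; exists B => x /hB; rewrite gh. Qed.

Lemma vanishesD g h : vanishes g -> vanishes h -> vanishes (fun x => g x + h x).
Proof.
move=> vg vh e e0; have e20 : 0 < e / 2 by rewrite divr_gt0.
have [B hB] := vg _ e20; have [C hC] := vh _ e20.
exists (Num.max B C) => x; rewrite ge_max => /andP[/hB gx /hC hx].
by rewrite (le_trans (ler_normD _ _))// [e]splitr lerD.
Qed.

Lemma vanishesM g h (K : R) : (exists B, forall x, B <= x -> `|g x| <= K) ->
  vanishes h -> vanishes (fun x => g x * h x).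
Proof.
move=> [B gK] vh e e0.
have K0 : 0 < `|K| + 1 by rewrite ltr_wpDl.
have [C hC] := vh (e / (`|K| + 1)) (divr_gt0 e0 K0).
exists (Num.max B C) => x; rewrite ge_max => /andP[/gK gx /hC hx].
rewrite normrM (@le_trans _ _ ((`|K| + 1) * (e / (`|K| + 1))))//.
  apply: ler_pM => //; rewrite (le_trans gx)// (le_trans (ler_norm K))//.
  by rewrite lerDl.
by rewrite mulrC divfK// gt_eqF.
Qed.

Lemma vanishesZ (k : R) h : vanishes h -> vanishes (fun x => k * h x).
Proof. by apply: (@vanishesM (fun=> k) h `|k|); exists 0. Qed.

Lemma vanishesN h : vanishes h -> vanishes (fun x => - h x).
Proof. by move=> /(vanishesZ (-1)); apply: vanishes_eq => x; rewrite mulN1r. Qed.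

Lemma vanishesB g h : vanishes g -> vanishes h -> vanishes (fun x => g x - h x).
Proof. by move=> vg /vanishesN; exact: vanishesD. Qed.

Lemma is_derive_MVT (F f : R -> R) a b : (forall x, is_derive x (1 : R) F (f x)) ->
  a <= b -> exists2 c, a <= c <= b & F b - F a = f c * (b - a).
Proof.
move=> dF ab; have [|c + E] := @MVT_segment R F f a b ab (fun x _ => dF x).
  exact: continuous_subspaceT (is_derive_continuous dF).
by rewrite in_itv/= => cab; exists c.
Qed.

Lemma is_derive_ge0_le (F f : R -> R) B : (forall x, is_derive x (1 : R) F (f x)) ->
  (forall x, B < x -> 0 <= f x) -> forall x y, B < x -> x <= y -> F x <= F y.
Proof.
move=> dF f0 x y Bx xy; have [c /andP[xc _] E] := is_derive_MVT dF xy.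
by rewrite -subr_ge0 E mulr_ge0 ?subr_ge0 ?f0// (lt_le_trans Bx).
Qed.

Lemma is_derive_le0_ge (F f : R -> R) B : (forall x, is_derive x (1 : R) F (f x)) ->
  (forall x, B < x -> f x <= 0) -> forall x y, B < x -> x <= y -> F y <= F x.
Proof.
move=> dF f0 x y Bx xy; have [c /andP[xc _] E] := is_derive_MVT dF xy.
by rewrite -subr_le0 E mulr_le0_ge0 ?subr_ge0 ?f0// (lt_le_trans Bx).
Qed.

(* The monotone derivative is squeezed between two difference quotients:
   g (2 x) - g x <= x g' x <= 2 (g x - g (x / 2)) when g' is nonincreasing. *)
Lemma vanishes_derive_nincr (g g' : R -> R) k B :
  (forall x, is_derive x (1 : R) g (g' x)) ->
  (forall x y, B < x -> x <= y -> g' y <= g' x) ->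
  vanishes (fun x => x ^+ k * g x) -> vanishes (fun x => x ^+ k.+1 * g' x).
Proof.
move=> dg mg vg e e0.
have K0 : 0 < 4 + 2 ^+ k.+1 :> R by rewrite addr_gt0// exprn_gt0.
set K : R := 4 + _ in K0.
have [C hC] := vg (e / K) (divr_gt0 e0 K0); set d := e / K in hC.
pose M := Num.max (Num.max B C) 0.
exists (2 * M + 1) => x Mx.
have BM : B <= M by rewrite !le_max lexx.
have CM : C <= M by rewrite !le_max lexx orbT.
have M0 : 0 <= M by rewrite !le_max lexx orbT.
have hBx : B < x / 2 by lra.
have x0 : 0 < x by lra.
have [c1 /andP[xc1 _] E1] := @is_derive_MVT g g' x (2 * x) dg ltac:(lra).
have [c2 /andP[xc2 c2x] E2] := @is_derive_MVT g g' (x / 2) x dg ltac:(lra).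
have m1 : g' c1 <= g' x by apply: mg => //; lra.
have m2 : g' x <= g' c2 by apply: mg => //; lra.
have L : g (2 * x) - g x <= x * g' x.
  by rewrite E1 (_ : 2 * x - x = x); [rewrite mulrC ler_pM2l|ring].
have U : x * g' x <= 2 * (g x - g (x / 2)).
  by rewrite E2 (_ : 2 * _ = x * g' c2); [rewrite ler_pM2l|field].
have a1 := hC x ltac:(lra); have a2 := hC (2 * x) ltac:(lra).
have a3 := hC (x / 2) ltac:(lra).
have d0 : 0 <= d by exact: le_trans a1.
have u0 : 0 <= x ^+ k by rewrite exprn_ge0 ?ltW.
have {}a2 : x ^+ k * `|g (2 * x)| <= d.
  apply: le_trans a2; rewrite normrM exprMn ger0_norm; last first.
    by rewrite mulr_ge0// exprn_ge0.
  by rewrite ler_wpM2r// ler_peMl// exprn_ege1// ler1n.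
have {}a3 : x ^+ k * `|g (x / 2)| <= 2 ^+ k * d.
  move: a3; rewrite normrM expr_div_n ger0_norm; last first.
    by rewrite divr_ge0// exprn_ge0.
  move=> /(ler_wpM2l (exprn_ge0 k (ler0n R 2))); apply: le_trans.
  by rewrite le_eqVlt; apply/orP; left; apply/eqP; field; rewrite expf_neq0.
have {}a1 : x ^+ k * `|g x| <= d by move: a1; rewrite normrM (ger0_norm u0).
have eE : e = 4 * d + 2 * (2 ^+ k * d).
  by rewrite /d /K exprS; field; rewrite gt_eqF// -exprS.
rewrite exprSr -mulrA ler_norml; apply/andP; split.
  apply: (@le_trans _ _ (x ^+ k * (g (2 * x) - g x))); last by rewrite ler_wpM2l.
  have : x ^+ k * (- `|g (2 * x)| - `|g x|) <= x ^+ k * (g (2 * x) - g x).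
    by rewrite ler_wpM2l// lerB ?ler_norm// lerNl -normrN ler_norm.
  have : 0 <= 2 ^+ k * d by rewrite mulr_ge0// exprn_ge0.
  by nra.
apply: (@le_trans _ _ (x ^+ k * (2 * (g x - g (x / 2))))); first by rewrite ler_wpM2l.
have : x ^+ k * (g x - g (x / 2)) <= x ^+ k * (`|g x| + `|g (x / 2)|).
  by rewrite ler_wpM2l// lerD ?ler_norm// -normrN ler_norm.
by nra.
Qed.

Lemma vanishes_derive_ndecr (g g' : R -> R) k B :
  (forall x, is_derive x (1 : R) g (g' x)) ->
  (forall x y, B < x -> x <= y -> g' x <= g' y) ->
  vanishes (fun x => x ^+ k * g x) -> vanishes (fun x => x ^+ k.+1 * g' x).
Proof.
move=> dg mg vg; have : vanishes (fun x => x ^+ k.+1 * - g' x).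
  apply: (@vanishes_derive_nincr (fun x => - g x) _ k B).
  - by move=> x y Bx xy; rewrite lerN2 mg.
  - by move: vg => /vanishesN; apply: vanishes_eq => x; rewrite mulrN.
by move=> /vanishesN; apply: vanishes_eq => x; rewrite mulrN opprK.
Qed.

Lemma smooth_is_derive f n x : smooth f ->
  is_derive x (1 : R) (derive1n n f) (derive1n n.+1 f x).
Proof. by move=> sf; rewrite derive1nS derive1E; apply: DeriveDef => //; exact: sf. Qed.

Lemma smooth_continuous f n : smooth f -> continuous (derive1n n f).
Proof. by move=> sf; exact: is_derive_continuous (fun x => smooth_is_derive n x sf). Qed.

Lemma bell_shaped_const_sign f n : bell_shaped f -> exists B,
  [/\ 0 <= B, (forall x, B < x -> 0 <= derive1n n f x) \/
     (forall x, B < x -> derive1n n f x <= 0) &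
  (forall x, x < - B -> 0 <= derive1n n f x) \/
     (forall x, x < - B -> derive1n n f x <= 0)].
Proof.
move=> [sf f0 _ _ fn]; case: n => [|n]; first by exists 0; split => //; left.
have [s [sg [_ sgE gs]]] := changes_sign_exactly_roots (fn n.+1).
have [B B0 sB] := seq_bound s; exists B; split => //.
  apply: roots_const_sign_right sgE gs _ => b /sB.
  by apply: le_trans; exact: ler_norm.
apply: roots_const_sign_left sgE gs _ => b /sB.
by rewrite lerNl; apply: le_trans; rewrite -normrN ler_norm.
Qed.

(** Induction on [k]: the eventual sign of [f^(k + 2)] makes [f^(k + 1)] monotone far out, and a
    monotone derivative inherits the decay of its primitive with one more power of [r]. The
    direction [e] covers both ends at once. *)
Lemma bell_shaped_decay f (c e : R) k : bell_shaped f -> e = 1 \/ e = -1 ->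
  vanishes (fun r => r ^+ k * derive1n k f (e * r + c)).
Proof.
move=> bf eE; have [sf _ fNy fy _] := bf.
elim: k => [|k IH].
  move=> eps eps0.
  have [B hB] : exists B, forall r, B <= r -> `|f (e * r + c)| <= eps.
    case: eE => ->.
      have := (cvgrPdist_le _ _).1 fy _ eps0 => -[B [_ hB]].
      by exists (B - c + 1) => r Br; rewrite -normrN -sub0r; apply: hB; lra.
    have := (cvgrPdist_le _ _).1 fNy _ eps0 => -[B [_ hB]].
    by exists (c - B + 1) => r Br; rewrite -normrN -sub0r; apply: hB; lra.
  by exists B => x /hB; rewrite mul1r.
have e2 : e * e = 1 by case: eE => ->; rewrite ?mulrNN mulr1.
pose G n r := derive1n n f (e * r + c).
have dG n r : is_derive r (1 : R) (G n) (e * G n.+1 r).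
  by apply: is_derive_affine; exact: smooth_is_derive.
have [B [B0 sR sL]] := bell_shaped_const_sign k.+2 bf.
pose C := B + `|c|.
have cC : c <= `|c| by exact: ler_norm.
have cC' : - c <= `|c| by rewrite -normrN ler_norm.
have sG : (forall r, C < r -> 0 <= G k.+2 r) \/ (forall r, C < r -> G k.+2 r <= 0).
  case: eE => eE; rewrite /G eE.
    case: sR => h; [left|right] => r Cr; apply: h; rewrite mul1r; move: Cr; rewrite /C; lra.
  case: sL => h; [left|right] => r Cr; apply: h; rewrite mulN1r; move: Cr; rewrite /C; lra.
have dG' r : is_derive r (1 : R) (fun r => e * G k.+1 r) (G k.+2 r).
  by have := is_derive_scale e (dG k.+1 r); rewrite mulrA e2 mul1r.
have : vanishes (fun r => r ^+ k.+1 * (e * G k.+1 r)).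
  case: sG => h.
    by apply: (vanishes_derive_ndecr (dG k) (is_derive_ge0_le dG' h) IH).
  by apply: (vanishes_derive_nincr (dG k) (is_derive_le0_ge dG' h) IH).
move=> /(vanishesZ e); apply: vanishes_eq => r.
by rewrite mulrCA (mulrA e) e2 mul1r.
Qed.

End Decay.

(** * The Cauchy transform *)

Section Kernel.
Variable R : realType.
Local Notation C := (R[i]).
Implicit Types (u t : R) (al be z w : C).

Definition ic : C := Complex 0 1.
(** The Cauchy kernel up to a unit: with [z = c + i u], [1 / (x - z) = i kv u (x - c)]. *)
Definition kv u t : C := (Complex u t)^-1.
(** Taking real parts keeps all integrals real. The complex weight [be] selects which real-linear
    functional of the complex integral is meant; [be = i] gives minus the imaginary part. *)
Definition ker (m : nat) be u t : R := Re (be * kv u t ^+ m).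

Lemma Re_mul z w : Re (z * w) = Re z * Re w - Im z * Im w.
Proof. by case: z w => [a b] [c d]. Qed.

Lemma Re_add z w : Re (z + w) = Re z + Re w.
Proof. by case: z w => [a b] [c d]. Qed.

Lemma Re_opp z : Re (- z) = - Re z.
Proof. by case: z. Qed.

Lemma Re_sub z w : Re (z - w) = Re z - Re w.
Proof. by case: z w => [a b] [c d]. Qed.

Lemma Re_scale (k : R) z : Re (k%:C%C * z) = k * Re z.
Proof. by rewrite Re_mul /= mul0r subr0. Qed.

Lemma Re_le_normc z : `|Re z| <= normc z.
Proof.
case: z => a b /=; rewrite -(sqrtr_sqr a); apply: ler_wsqrtr.
by rewrite lerDl sqr_ge0.
Qed.

Lemma normc_ge0 z : 0 <= normc z.
Proof. by case: z => a b /=; exact: sqrtr_ge0. Qed.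

Lemma normcX z n : normc (z ^+ n) = normc z ^+ n.
Proof. by elim: n => [|n IH]; rewrite ?expr0 ?normc1// !exprS normcM IH. Qed.

Lemma normc_real (k : R) : normc k%:C%C = `|k|.
Proof. by rewrite /= expr0n/= addr0 sqrtr_sqr. Qed.

Lemma normc_sqr z : normc z ^+ 2 = Re z ^+ 2 + Im z ^+ 2.
Proof. by case: z => a b /=; rewrite sqr_sqrtr// addr_ge0 ?sqr_ge0. Qed.

Lemma normc_ic : normc ic = 1.
Proof. by rewrite /= expr0n expr1n/= add0r sqrtr1. Qed.

Lemma Complex_neq0 u t : 0 < u -> Complex u t != 0.
Proof. by move=> u0; apply/eqP => -[/eqP]; rewrite gt_eqF. Qed.

Lemma kv_mul u t : 0 < u -> Complex u t * kv u t = 1.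
Proof. by move=> u0; rewrite mulfV// Complex_neq0. Qed.

Lemma kvE u t : kv u t = Complex (u / (u ^+ 2 + t ^+ 2)) (- (t / (u ^+ 2 + t ^+ 2))).
Proof. by []. Qed.

Lemma sqr_sum_gt0 u t : 0 < u -> 0 < u ^+ 2 + t ^+ 2.
Proof. by move=> u0; rewrite ltr_wpDr ?sqr_ge0// exprn_gt0. Qed.

Lemma Re_kv_normc u t : 0 < u -> Re (kv u t) = u * normc (kv u t) ^+ 2.
Proof.
move=> u0; rewrite normc_sqr kvE /=; field.
by rewrite gt_eqF// sqr_sum_gt0.
Qed.

Lemma normc_kv u t : 0 < u -> normc (kv u t) <= u^-1.
Proof.
move=> u0; rewrite normcV /= lef_pV2 ?posrE ?sqrtr_gt0 ?sqr_sum_gt0//.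
rewrite -[leLHS]gtr0_norm// -sqrtr_sqr; apply: ler_wsqrtr.
by rewrite lerDl sqr_ge0.
Qed.

Lemma is_derive_ker1 be u t : 0 < u ->
  is_derive t (1 : R) (fun t => Re (be * kv u t)) (Re (- ic * be * kv u t ^+ 2)).
Proof.
move=> u0; case: be => a b.
have d0 s : u ^+ 2 + s ^+ 2 != 0 by rewrite gt_eqF// sqr_sum_gt0.
have -> : (fun t => Re (Complex a b * kv u t)) =
    (fun t => (a * u + b * t) * (u ^+ 2 + t ^+ 2)^-1).
  by apply/funext => s; rewrite kvE /=; field.
have H1 : is_derive t (1 : R) (fun t => a * u + b * t) b.
  have := is_derive_add (is_derive_cst (a * u) t 1) (is_derive_scale b (is_derive_id t 1)).
  by rewrite add0r mulr1.
have H2 : is_derive t (1 : R) (fun t => u ^+ 2 + t ^+ 2) (2 * t).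
  have H := is_derive_mul (is_derive_id t 1) (is_derive_id t 1).
  refine (is_derive_eq (is_derive_add (is_derive_cst (u ^+ 2) t 1) H) _).
  by ring.
have H3 : is_derive t (1 : R) (fun t => (u ^+ 2 + t ^+ 2)^-1)
    (- (u ^+ 2 + t ^+ 2) ^- 2 * (2 * t)).
  exact: (@is_deriveV R (fun t => u ^+ 2 + t ^+ 2) t (2 * t) 1 (d0 t) H2).
refine (is_derive_eq (is_derive_mul H1 H3) _).
rewrite kvE exprS expr1 /ic /=; field; exact: d0.
Qed.

(** [d/dt (u + i t)^-m = - i m (u + i t)^(- m - 1)]. The induction splits the real part of a product
    into products of real parts by means of [Im z = Re (- i z)], so that only real derivatives
    occur. *)
Lemma is_derive_ker m be u t : 0 < u ->
  is_derive t (1 : R) (ker m be u) (ker m.+1 (- ic * be * m%:R) u t).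
Proof.
move=> u0; elim: m be => [|m IH] be.
  have -> : ker 0 be u = fun=> Re be by apply/funext => s; rewrite /ker expr0 mulr1.
  by rewrite /ker mulr0 mul0r; exact: is_derive_cst.
have -> : ker m.+1 be u = fun t => Re (be * kv u t) * ker m 1 u t -
    Re (- ic * be * kv u t) * ker m (- ic) u t.
  apply/funext => s; rewrite /ker exprS mulrA Re_mul mul1r.
  case: (kv u s ^+ m) => p q; case: (kv u s) => x y; case: {IH} be => a b /=.
  by ring.
refine (is_derive_eq (is_derive_sub
  (is_derive_mul (is_derive_ker1 be t u0) (IH 1))
  (is_derive_mul (is_derive_ker1 (- ic * be) t u0) (IH (- ic)))) _).
have mE : m%:R = Complex m%:R 0 :> C by rewrite -(rmorph_nat (real_complex R)).
rewrite /ker !exprS expr0 -natr1 mE.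
case: (kv u t ^+ m) => p q; case: (kv u t) => x y; case: be => a b /=.
by ring.
Qed.

End Kernel.

(** * Integration by parts on growing intervals *)

Section Asymptotics.
Variables (R : realType) (f : R -> R) (c : R).
Local Notation C := (R[i]).
Hypothesis bf : bell_shaped f.
Implicit Types (s : seq R) (p : {poly R}) (al be : C) (u r : R).

Let sf : smooth f. Proof. by case: bf. Qed.
Let cd n : continuous (derive1n n f). Proof. exact: smooth_continuous. Qed.
Let dd n x : is_derive x (1 : R) (derive1n n f) (derive1n n.+1 f x).
Proof. exact: smooth_is_derive. Qed.

Definition crint r (h : R -> R) : R := rint (c - r) (c + r) h.

Lemma vanishes_sum k (h : nat -> R -> R) : (forall i, (i < k)%N -> vanishes (h i)) ->
  vanishes (fun r => \sum_(i < k) h i r).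
Proof.
elim: k => [|k IH] hv.
  by move=> e e0; exists 0 => x _; rewrite big_ord0 normr0 ltW.
apply: (@vanishes_eq _ (fun r => \sum_(i < k) h i r + h k r)).
  by move=> r; rewrite big_ord_recr.
by apply: vanishesD; [apply: IH => i ik; apply: hv; rewrite ltnW|exact: hv].
Qed.

Lemma vanishes_expr_le (h : R -> R) j k : (j <= k)%N ->
  vanishes (fun r => r ^+ k * h r) -> vanishes (fun r => r ^+ j * h r).
Proof.
move=> jk hv e /hv[B hB]; exists (Num.max B 1) => x.
rewrite ge_max => /andP[/hB + x1]; apply: le_trans.
by rewrite !normrM ler_wpM2r// !normrX ler_weXn2l// ger0_norm// (le_trans ler01).
Qed.

Lemma vanishes_horner (h : R -> R) p k : (size p <= k.+1)%N ->
  vanishes (fun r => r ^+ k * h r) -> vanishes (fun r => p.[r] * h r).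
Proof.
move=> sp hv; apply: (@vanishes_eq _ (fun r => \sum_(i < k.+1) p`_i * (r ^+ i * h r))).
  by move=> r; rewrite (horner_coef_wide _ sp) big_distrl /=; apply: eq_bigr => i _; rewrite mulrA.
apply: (@vanishes_sum k.+1 (fun i r => p`_i * (r ^+ i * h r))) => i ik.
by apply: vanishesZ; exact: vanishes_expr_le hv.
Qed.

(** These are the boundary terms: a polynomial of degree at most [n] is beaten by
    [f^(n) = o(r^-n)]. *)
Lemma vanishes_boundary n p (e : R) : (size p <= n.+1)%N -> e = 1 \/ e = -1 ->
  vanishes (fun r => derive1n n f (c + e * r) * p.[c + e * r]).
Proof.
move=> sp eE; have := bell_shaped_decay c n bf eE.
have sq : (size (p \Po (e *: 'X + c%:P)) <= n.+1)%N.
  have [->|p0] := eqVneq p 0; first by rewrite comp_poly0 size_poly0.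
  apply: (leq_trans (size_comp_poly_leq _ _)).
  have : (size (e *: 'X + c%:P)%R <= 2)%N.
    rewrite (leq_trans (size_polyD _ _))// geq_max; apply/andP; split.
      by rewrite (leq_trans (size_scale_leq _ _))// size_polyX.
    by rewrite (leq_trans (size_polyC_leq1 _)).
  move=> s2; rewrite -ltnS in sp; rewrite ltnS.
  apply: (@leq_trans ((size p).-1 * 1)%N); last by rewrite muln1 -ltnS prednK// size_poly_gt0.
  by rewrite leq_mul2l; apply/orP; right; rewrite -subn1 leq_subLR.
move=> /(vanishes_horner sq); apply: vanishes_eq => r.
by rewrite horner_comp !hornerE mulrC [c + _]addrC.
Qed.

(** Each integration by parts lowers both the order of the derivative and the bound on the degree of
    [p], until [p = 0]. *)
Lemma vanishes_crint_poly n : forall p, (size p <= n)%N ->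
  vanishes (fun r => crint r (fun x => derive1n n f x * p.[x])).
Proof.
elim: n => [|n IH] p sp.
  move: sp; rewrite leqn0 size_poly_eq0 => /eqP ->.
  move=> e e0; exists 0 => r r0; rewrite /crint.
  rewrite (_ : (fun x => _) = (fun=> 0)).
    by rewrite rint_cst; [rewrite mul0r normr0 ltW|lra].
  by apply/funext => x; rewrite horner0 mulr0.
have sp' : (size p^`() <= n)%N.
  by rewrite (leq_trans (size_poly _ _))// -subn1 leq_subLR add1n.
have v1 := vanishes_boundary sp (or_introl erefl).
have v2 := vanishes_boundary sp (or_intror erefl).
have := vanishesB (vanishesB v1 v2) (IH _ sp') => v e e0.
have [B hB] := v e e0.
exists (Num.max B 0) => r; rewrite ge_max => /andP[/hB + r0].
have ab : c - r <= c + r by lra.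
rewrite /crint mul1r mulN1r.
by rewrite (rint_by_parts ab (@cd n.+1) (@continuous_horner _ p^`()) (dd n) (is_derive_poly p)).
Qed.

Lemma continuous_ker m be u : 0 < u -> continuous (fun x => ker m be u (x - c)).
Proof.
move=> u0; apply: (@is_derive_continuous _ _ (fun x => ker m.+1 (- ic R * be * m%:R) u (x - c))) => x.
by apply: is_derive_shift; exact: is_derive_ker.
Qed.

Lemma ker_abs m be u t : 0 < u -> `|ker m be u t| <= normc be * u^-1 ^+ m.
Proof.
move=> u0; rewrite (le_trans (Re_le_normc _))// normcM normcX ler_wpM2l ?normc_ge0//.
apply: lerXn2r; rewrite ?nnegrE ?normc_ge0 ?invr_ge0 ?(ltW u0)//.
exact: normc_kv.
Qed.

Lemma vanishes_crint_ker_step n m be u : 0 < u ->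
  vanishes (fun r => crint r (fun x => derive1n n.+1 f x * ker m be u (x - c)) -
    crint r (fun x => derive1n n f x * ker m.+1 (ic R * be * m%:R) u (x - c))).
Proof.
move=> u0.
have v (e : R) : e = 1 \/ e = -1 ->
    vanishes (fun r => ker m be u (e * r) * derive1n n f (c + e * r)).
  move=> eE; apply: (@vanishesM _ _ _ (normc be * u^-1 ^+ m)).
    by exists 0 => x _; exact: ker_abs.
  have : (size (1 : {poly R})%R <= n.+1)%N by rewrite size_poly1.
  move=> /vanishes_boundary => /(_ e eE); apply: vanishes_eq => r.
  by rewrite hornerC mulr1.
have := vanishesB (v 1 (or_introl erefl)) (v (-1) (or_intror erefl)) => {}v e e0.
have [B hB] := v e e0.
exists (Num.max B 0) => r; rewrite ge_max => /andP[/hB + r0].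
have dk x : is_derive x (1 : R) (fun x => ker m be u (x - c)) (ker m.+1 (- ic R * be * m%:R) u (x - c)).
  by apply: is_derive_shift; exact: is_derive_ker.
have ck := @continuous_ker m.+1 (- ic R * be * m%:R) u u0.
have ab : c - r <= c + r by lra.
rewrite /crint mul1r mulN1r (rint_by_parts ab (@cd n.+1) ck (dd n) dk).
rewrite (_ : (fun x => derive1n n f x * ker m.+1 (ic R * be * m%:R) u (x - c)) =
  (fun x => -1 * (derive1n n f x * ker m.+1 (- ic R * be * m%:R) u (x - c)))); last first.
  by apply/funext => x; rewrite /ker !mulNr Re_opp mulrN mul1r opprK.
rewrite rintZ; last exact: continuous_mul.
rewrite (_ : c + r - c = r); last by ring.
rewrite (_ : c - r - c = - r); last by ring.
by rewrite mulN1r opprK subrK ![ker _ _ _ _ * _]mulrC.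
Qed.

(* [K] is [(j + 1) * ... * (j + n)], but only its sign matters. *)
Lemma vanishes_crint_ker n : forall j, exists2 K : R, 0 < K & forall be u, 0 < u ->
  vanishes (fun r => crint r (fun x => derive1n n.+1 f x * ker j.+1 be u (x - c)) -
    K * crint r (fun x => derive1n 1 f x * ker (j.+1 + n) (be * ic R ^+ n) u (x - c))).
Proof.
elim: n => [|n IH] j.
  exists 1 => // be u u0 e e0; exists 0 => r _.
  by rewrite expr0 mulr1 addn0 mul1r subrr normr0 ltW.
have [K K0 hK] := IH j.+1.
exists (j.+1%:R * K); first by rewrite mulr_gt0.
move=> be u u0.
have := vanishesD (vanishes_crint_ker_step n.+1 j.+1 be u0)
  (hK (ic R * be * j.+1%:R) u u0).
apply: vanishes_eq => r; rewrite addrA subrK; congr (_ - _).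
rewrite addSnnS [j.+1%:R * K]mulrC -[K * _ * _]mulrA; congr (_ * _).
rewrite /crint -rintZ; last first.
  by apply: continuous_mul; [exact: cd|exact: continuous_ker].
congr rint; apply/funext => x; rewrite mulrCA; congr (_ * _).
rewrite /ker -Re_scale; congr Re; rewrite exprS.
by rewrite -[in LHS](rmorph_nat (real_complex R)); ring.
Qed.

(** The value of [prod (b - x)] at [x = c + i u]. *)
Definition pis u s : C := \prod_(b <- s) Complex (b - c) (- u).

(** Write [b - x = (b - z) - (x - z)] with [z = c + i u]. The first term contributes one factor of
    [pis]; the second cancels the Cauchy kernel and leaves a polynomial of degree below [n], which
    [f^(n)] annihilates in the limit. *)
Lemma vanishes_crint_roots n s u : (size s <= n)%N -> 0 < u -> forall al,
  vanishes (fun r =>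
    crint r (fun x => derive1n n f x * \prod_(b <- s) (b - x) * ker 1 al u (x - c)) -
    crint r (fun x => derive1n n f x * ker 1 (al * pis u s) u (x - c))).
Proof.
move=> + u0; elim: s => [|b s IH] /= sn al.
  move=> e e0; exists 0 => r _; rewrite /pis big_nil mulr1.
  by under [in X in crint r X - _]eq_fun do rewrite big_nil mulr1; rewrite subrr normr0 ltW.
pose p : {poly R} := \prod_(b <- s) (b%:P - 'X).
have pE x : p.[x] = \prod_(b <- s) (b - x).
  by rewrite horner_prod; apply: eq_bigr => a _; rewrite !hornerE.
have sp : (size p <= n)%N.
  apply: leq_trans sn; rewrite /p; elim: (s) => [|a s' IHs].
    by rewrite big_nil size_poly1.
  rewrite big_cons /= (leq_trans (size_polyMleq _ _))//.
  by rewrite -opprB size_polyN size_XsubC add2n /= ltnS.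
have := vanishesD (IH (ltnW sn) (al * Complex (b - c) (- u)))
  (vanishesZ (Re (al * ic R)) (vanishes_crint_poly sp)).
have cp : continuous (fun x => \prod_(b <- s) (b - x)).
  by under eq_fun do rewrite -pE; exact: continuous_horner.
have ck m be := @continuous_ker m be u u0.
have cfp : continuous (fun x => derive1n n f x * p.[x]).
  by apply: continuous_mul; [exact: cd|exact: continuous_horner].
apply: vanishes_eq => r; rewrite /crint addrAC; congr (_ - _); last first.
  by rewrite /pis big_cons mulrA.
rewrite -rintZ -?rintD.
- congr rint; apply/funext => x; rewrite big_cons pE.
  set P := \prod_(b <- s) _; set F := derive1n n f x.
  have -> : Re (al * ic R) * (F * P) = F * P * Re (al * ic R) by ring.
  rewrite -mulrDr -mulrA [(b - x) * P]mulrC -!mulrA; congr (_ * (_ * _)).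
  rewrite /ker !expr1 -Re_add -Re_scale; congr Re.
  have V := kv_mul (x - c) u0; set v := kv _ _ in V *.
  rewrite -!mulrA -mulrDr mulrCA; congr (_ * _).
  (* This is [b - x = (b - c - i u) + i (u + i (x - c))] multiplied by [v]. *)
  have -> : ic R = ic R * (Complex u (x - c) * v) by rewrite V mulr1.
  rewrite mulrA -mulrDl; congr (_ * _).
  by apply/eqP; rewrite eq_complex /=; apply/andP; split; apply/eqP; ring.
- by apply: continuous_mul => //; apply: continuous_mul.
- exact: continuous_scale cfp.
- exact: cfp.
Qed.

End Asymptotics.

(** * Comparison of the Cauchy transform at two heights *)

Section Comparison.
Variable R : realType.
Local Notation C := (R[i]).
Implicit Types (s : seq R) (al be : C).

Lemma normc_Complex_scale (a u1 u2 : R) : 0 < u1 -> u1 <= u2 ->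
  normc (Complex a (- u2)) <= u2 / u1 * normc (Complex a (- u1)).
Proof.
move=> u10 u12 /=; have u20 : 0 < u2 by exact: lt_le_trans u12.
rewrite -[u2 / u1]ger0_norm ?divr_ge0 ?(ltW u10) ?(ltW u20)//.
rewrite -sqrtr_sqr -sqrtrM ?sqr_ge0//; apply: ler_wsqrtr.
rewrite mulrDr [X in _ <= _ + X](_ : _ = (- u2) ^+ 2); last first.
  by field; rewrite gt_eqF.
rewrite lerD2r ler_peMl ?sqr_ge0// expr_ge1 ?divr_ge0 ?(ltW u10) ?(ltW u20)//.
by rewrite ler_pdivlMr// mul1r.
Qed.

(** For [|a| >= u2] the modulus is at most [sqrt 2 |a|], however small [u1] is compared with
    [u2]. *)
Lemma normc_Complex_far (a u1 u2 : R) : 0 < u2 -> u2 <= `|a| ->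
  normc (Complex a (- u2)) <= 2 * normc (Complex a (- u1)).
Proof.
move=> u20 u2a /=; rewrite -[2]ger0_norm// -sqrtr_sqr -sqrtrM ?sqr_ge0//.
apply: ler_wsqrtr; have : u2 ^+ 2 <= a ^+ 2 by rewrite -[a ^+ 2]real_normK ?num_real// lerXn2r ?nnegrE// ltW.
by rewrite !sqrrN; have := sqr_ge0 u1; nra.
Qed.

Lemma normc_pis_scale (c u1 u2 : R) s : 0 < u1 -> u1 <= u2 ->
  normc (pis c u2 s) <= (u2 / u1) ^+ size s * normc (pis c u1 s).
Proof.
move=> u10 u12; have u20 : 0 < u2 by exact: lt_le_trans u12.
elim: s => [|b s IH]; first by rewrite /pis !big_nil normc1 expr0 mulr1.
rewrite /pis !big_cons !normcM [size _]/= exprS mulrACA.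
by rewrite ler_pM ?normc_ge0//; exact: normc_Complex_scale.
Qed.

(** One far root costs a factor 2 where [normc_pis_scale] allows [u2 / u1]. The factor [u2 / u1]
    saved in this way pays for the loss in [ker1_compare]. *)
Lemma normc_pis_far (c u1 u2 b : R) s : 0 < u1 -> u1 <= u2 -> b \in s ->
  u2 <= `|b - c| ->
  normc (pis c u2 s) * (u2 / u1) <= 2 * (u2 / u1) ^+ size s * normc (pis c u1 s).
Proof.
move=> u10 u12 + ub; have u20 : 0 < u2 by exact: lt_le_trans u12.
elim: s => // a s IH; rewrite inE => /predU1P[<-|/IH {}IH].
  have h1 := normc_pis_scale c s u10 u12.
  have h2 := normc_Complex_far u1 u20 ub.
  rewrite /pis !big_cons !normcM [size (_ :: _)]/= exprS in h1 h2 *.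
  rewrite [leRHS](_ : _ = (2 * normc (Complex (b - c) (- u1))) *
    ((u2 / u1) ^+ size s * normc (\prod_(b <- s) Complex (b - c) (- u1))) * (u2 / u1)).
    by rewrite ler_wpM2r ?divr_ge0 ?(ltW u10) ?(ltW u20)// ler_pM ?normc_ge0.
  by ring.
have h := normc_Complex_scale (a - c) u10 u12.
rewrite /pis !big_cons !normcM [size (_ :: _)]/= exprS in h IH *.
rewrite [leRHS](_ : _ = (u2 / u1 * normc (Complex (a - c) (- u1))) *
  (2 * (u2 / u1) ^+ size s * normc (\prod_(b <- s) Complex (b - c) (- u1)))).
  by rewrite -mulrA ler_pM ?normc_ge0// mulr_ge0 ?normc_ge0// divr_ge0 ?(ltW u10) ?(ltW u20).
by ring.
Qed.

Lemma pis_neq0 (c u : R) s : 0 < u -> pis c u s != 0.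
Proof.
move=> u0; rewrite /pis prodf_seq_neq0; apply/allP => b _ /=.
by apply/eqP => -[_ /eqP]; rewrite oppr_eq0 gt_eqF.
Qed.

(** Resolvent identity [kv u1 - kv u2 = (u2 - u1) kv u1 kv u2], together with
    [|kv u1| <= (u2 / u1) |kv u2|]. The product [u2 |kv u2|^2] is [Re (kv u2)], the positive Cauchy
    kernel, so the error is again an integral of the same kind. *)
Lemma ker1_compare al (u1 u2 t : R) : 0 < u1 -> u1 <= u2 ->
  `|ker 1 al u1 t - ker 1 al u2 t| <= normc al * ((u2 - u1) / u1) * ker 1 1 u2 t.
Proof.
move=> u10 u12; have u20 : 0 < u2 by exact: lt_le_trans u12.
rewrite /ker !expr1 mul1r -Re_sub -mulrBr Re_kv_normc//.
have n10 := Complex_neq0 t u10; have n20 := Complex_neq0 t u20.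
have -> : kv u1 t - kv u2 t = (u2 - u1)%:C%C * (kv u1 t * kv u2 t).
  have -> : (u2 - u1)%:C%C = Complex u2 t - Complex u1 t.
    by apply/eqP; rewrite eq_complex /= subrr !eqxx.
  by rewrite /kv; field; rewrite n10 n20.
apply: le_trans (Re_le_normc _) _; rewrite !normcM normc_real ger0_norm ?subr_ge0//.
rewrite -!mulrA ler_wpM2l ?normc_ge0// ler_wpM2l ?subr_ge0//.
rewrite expr2 !mulrA ler_wpM2r ?normc_ge0//.
have : normc (kv u1 t) <= u2 / u1 * normc (kv u2 t).
  have h := normc_Complex_scale t u10 u12.
  rewrite /kv !normcV.
  have e1 (u : R) : normc (Complex u t) = normc (Complex t (- u)).
    by rewrite /= sqrrN addrC.
  rewrite !e1; have p (u : R) : 0 < u -> 0 < normc (Complex t (- u)).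
    by move=> u0; rewrite -e1 /= sqrtr_gt0 sqr_sum_gt0.
  rewrite -[leLHS]mul1r ler_pdivrMr ?p// mulrAC ler_pdivlMr ?p// mul1r.
  exact: h.
by rewrite [u1^-1 * _]mulrC.
Qed.

Variables (f : R -> R) (c : R) (n : nat) (s : seq R) (sg : R).
Hypothesis bf : bell_shaped f.
Hypothesis sn : (size s <= n.+1)%N.
Hypothesis sgE : sg = 1 \/ sg = -1.
Hypothesis gs : forall x, 0 <= sg * derive1n n.+1 f x * \prod_(b <- s) (b - x).

Let sf : smooth f. Proof. by case: bf. Qed.

(** From [f^(n + 1)] down to [f'] there are [n] integrations by parts, which raise the kernel from
    the power 1 to the power [n + 1]. *)
Definition fker (r : R) be (u : R) : R :=
  crint c r (fun x => derive1n 1 f x * ker n.+1 be u (x - c)).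

Let S (r : R) al (u : R) : R :=
  crint c r (fun x => derive1n n.+1 f x * \prod_(b <- s) (b - x) * ker 1 al u (x - c)).

Let cS al u : 0 < u -> continuous (fun x =>
  derive1n n.+1 f x * \prod_(b <- s) (b - x) * ker 1 al u (x - c)).
Proof.
move=> u0; apply: continuous_mul; last exact: continuous_ker.
apply: continuous_mul; first exact: smooth_continuous.
elim: (s) => [|b s' IH].
  by under eq_fun do rewrite big_nil; move=> x; exact: cvg_cst.
under eq_fun do rewrite big_cons; apply: continuous_mul => //.
by apply: continuous_sub => x; [exact: cvg_cst|exact: cvg_id].
Qed.

Lemma fker_scale (r k : R) be (u : R) : 0 < u -> fker r (k%:C%C * be) u = k * fker r be u.
Proof.
move=> u0; rewrite /fker /crint -rintZ; last first.
  by apply: continuous_mul; [exact: smooth_continuous|exact: continuous_ker].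
by congr rint; apply/funext => x; rewrite mulrCA /ker -mulrA Re_scale.
Qed.

(** [K] depends neither on [al] nor on [u], so it cancels when two heights are compared. *)
Lemma vanishes_fker : exists2 K : R, 0 < K & forall al u, 0 < u ->
  vanishes (fun r => S r al u - K * fker r (al * pis c u s * ic R ^+ n) u).
Proof.
have [K K0 hK] := vanishes_crint_ker c bf n 0; exists K => // al u u0.
have := vanishesD (vanishes_crint_roots c bf sn u0 al) (hK (al * pis c u s) u u0).
by apply: vanishes_eq => r; rewrite addrA subrK.
Qed.

(** The weight [sg f^(n + 1) P] is nonnegative, so the pointwise comparison of the kernels can be
    integrated against it. *)
Let S_compare r al u1 u2 : 0 < u1 -> u1 <= u2 ->
  sg * S r al u1 <= sg * S r al u2 + normc al * ((u2 - u1) / u1) * (sg * S r 1 u2).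
Proof.
move=> u10 u12; have u20 : 0 < u2 by exact: lt_le_trans u12.
have k1 := @continuous_scale R sg _ (@cS al u1 u10).
have k2 := @continuous_scale R sg _ (@cS al u2 u20).
have k3 := @continuous_scale R (normc al * ((u2 - u1) / u1)) _
  (@continuous_scale R sg _ (@cS 1 u2 u20)).
have k4 := @continuous_scale R sg _ (@cS 1 u2 u20).
rewrite /S /crint -(rintZ _ _ _ (@cS al u1 u10)) -(rintZ _ _ _ (@cS al u2 u20)).
rewrite -(rintZ _ _ _ (@cS 1 u2 u20)) -(rintZ _ _ _ k4) -(rintD _ _ k2 k3).
apply: rint_le; [exact: k1|exact: continuous_add k2 k3|].
move=> x _; set F := derive1n n.+1 f x; set P := \prod_(b <- s) _.
have := ker1_compare al (x - c) u10 u12; rewrite ler_norml => /andP[_ h].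
have := gs x; rewrite -/F -/P => g0; have := ler_wpM2l g0 h.
rewrite mulrBr -subr_ge0 => h'; rewrite -subr_ge0.
by apply: le_trans h' _; rewrite le_eqVlt; apply/orP; left; apply/eqP; ring.
Qed.

(** The chain is [fker] at [u1], [S] at [u1], [S] at [u2], [fker] at [u2]. The weight [al] divides
    [be] by the value of [P] at height [u1], so the ratio of the two values of [P] appears, which
    [q] controls. *)
Lemma fker_compare (u1 u2 d q : R) be e : 0 < u1 -> u1 <= u2 -> 0 <= d ->
  (exists B, forall r, B <= r -> forall be, `|fker r be u2| <= d * normc be) ->
  normc (pis c u2 s) * (u2 / u1) <= q * normc (pis c u1 s) ->
  0 < e -> exists B, forall r, B <= r -> sg * fker r be u1 <= d * q * normc be + e.
Proof.
move=> u10 u12 d0 [B0 hd] hq e0; have u20 : 0 < u2 by exact: lt_le_trans u12.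
have p10 := pis_neq0 c s u10.
have i0 : ic R ^+ n != 0.
  by rewrite expf_neq0//; apply/eqP => -[] /eqP; rewrite oner_eq0.
have [K K0 hK] := vanishes_fker.
set p1 := pis c u1 s in p10 hq; set p2 := pis c u2 s in hq.
have [al alE] : exists al, al * p1 * ic R ^+ n = be.
  by exists (be / (p1 * ic R ^+ n)); field; rewrite p10 i0.
have np1 : 0 < normc p1.
  by rewrite lt_neqAle normc_ge0 andbT eq_sym; apply: contra p10 => /eqP/eq0_normc ->.
have nal : normc al * normc p1 = normc be.
  by rewrite -alE !normcM normcX normc_ic expr1n mulr1.
pose rho := normc al * ((u2 - u1) / u1).
have rho0 : 0 <= rho by rewrite mulr_ge0 ?normc_ge0// divr_ge0 ?subr_ge0// ltW.
(* Three limits are used up to [eta], with weights 1, 1 and [rho]. *)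
pose eta := K * e / (2 + rho).
have eta0 : 0 < eta by rewrite divr_gt0 ?mulr_gt0// ltr_wpDr.
have [B1 h1] := hK al u1 u10 eta eta0.
have [B2 h2] := hK al u2 u20 eta eta0.
have [B3 h3] := hK 1 u2 u20 eta eta0.
exists (Num.max (Num.max B0 B1) (Num.max B2 B3)) => r.
rewrite !ge_max => /andP[/andP[r0 /h1 {}h1] /andP[/h2 {}h2 /h3 {}h3]].
have {}hd := hd r r0.
have ha2 : `|fker r (al * p2 * ic R ^+ n) u2| <= d * (normc al * normc p2).
  by apply: le_trans (hd _) _; rewrite !normcM normcX normc_ic expr1n mulr1.
have ha3 : `|fker r (1 * p2 * ic R ^+ n) u2| <= d * normc p2.
  by apply: le_trans (hd _) _; rewrite !normcM normcX normc_ic normc1 expr1n mulr1 mul1r.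
move: h1 h2 h3 ha2 ha3; rewrite alE -/p2.
have := S_compare r al u10 u12; rewrite -/rho.
set S1 := S r al u1; set S2 := S r al u2; set S3 := S r 1 u2.
set a1 := fker _ be _; set a2 := fker _ _ _; set a3 := fker _ _ _.
have sg_le (x y : R) : `|x| <= y -> sg * x <= y.
  by rewrite ler_norml => /andP[? ?]; case: sgE => ->; lra.
have sg_ge (x y : R) : `|x| <= y -> - y <= sg * x.
  by rewrite ler_norml => /andP[? ?]; case: sgE => ->; lra.
move=> hS h1 h2 h3 /sg_le ha2 /sg_le ha3.
have c1 : K * (sg * a1) <= sg * S1 + eta.
  by have := sg_ge _ _ h1; rewrite mulrBr [sg * (K * _)]mulrCA; clear; lra.
have c2 : sg * S2 <= K * (d * (normc al * normc p2)) + eta.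
  have := ler_wpM2l (ltW K0) ha2.
  by have := sg_le _ _ h2; rewrite mulrBr [sg * (K * _)]mulrCA; clear; lra.
have c3 : sg * S3 <= K * (d * normc p2) + eta.
  have := ler_wpM2l (ltW K0) ha3.
  by have := sg_le _ _ h3; rewrite mulrBr [sg * (K * _)]mulrCA; clear; lra.
have c4 := ler_wpM2l rho0 c3.
(* The main term and the error of the kernel comparison add up through
   [1 + (u2 - u1) / u1 = u2 / u1]. *)
have c5 : K * (sg * a1) <= K * (d * (normc al * (normc p2 * (u2 / u1)))) + eta * (2 + rho).
  have -> : K * (d * (normc al * (normc p2 * (u2 / u1)))) =
    K * (d * (normc al * normc p2)) + rho * (K * (d * normc p2)).
    by rewrite /rho; field; rewrite gt_eqF.
  by move: c1 c2 c4 hS; clear; lra.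
rewrite -(ler_pM2l K0); apply: (le_trans c5).
rewrite /eta divfK ?gt_eqF ?ltr_wpDr// mulrDr lerD2r ler_pM2l// -mulrA ler_wpM2l//.
by rewrite -nal [q * _]mulrCA ler_wpM2l ?normc_ge0.
Qed.

End Comparison.

(** * Fubini on a rectangle *)

Section Fubini.
Variable R : realType.
Local Notation mu := (@lebesgue_measure R).
Local Notation TR := (measurableTypeR R).
Local Open Scope ereal_scope.

Lemma rint_fubini (F : R -> R -> R) (a b a' b' M : R) :
  measurable_fun setT (fun z : TR * TR => F z.1 z.2) ->
  (forall x y, a <= x <= b -> a' <= y <= b' -> `|F x y| <= M)%R ->
  [/\ mu.-integrable `[a, b] (fun x => (rint a' b' (F x))%:E),
      mu.-integrable `[a', b'] (fun y => (rint a b (F^~ y))%:E) &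
      rint a b (fun x => rint a' b' (F x)) = rint a' b' (fun y => rint a b (F^~ y))].
Proof.
move=> mF bF.
pose A : set TR := `[a, b]%classic; pose B : set TR := `[a', b']%classic.
have mA : measurable A by exact: measurable_itv.
have mB : measurable B by exact: measurable_itv.
pose G : TR * TR -> \bar R := (fun z : TR * TR => (F z.1 z.2)%:E) \_ (A `*` B).
have mG : measurable_fun setT G.
  apply/(measurable_restrictT _ (measurableX mA mB)).
  by apply: measurable_funTS; exact/measurable_EFinP.
have muA : mu A < +oo.
  by rewrite /A lebesgue_measure_itv /=; case: ifP => _; rewrite -?EFinB ltry.
have muB : mu B < +oo.
  by rewrite /B lebesgue_measure_itv /=; case: ifP => _; rewrite -?EFinB ltry.
have mF1 x : measurable_fun setT (F x : TR -> R).
  exact: (measurable_fun_pair2 x mF).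
have mF2 y : measurable_fun setT (F^~ y : TR -> R).
  exact: (measurable_fun_pair1 y mF).
have iF1 x : A x -> mu.-integrable B (fun y => (F x y)%:E).
  move=> Ax; apply: measurable_bounded_integrable => //.
    by apply: measurable_funTS; exact: mF1.
  exists M; split; first exact: num_real.
  move=> K MK y By /=; apply: le_trans (ltW MK); apply: bF.
    by move: Ax; rewrite /A /= in_itv.
  by move: By; rewrite /B /= in_itv.
have iF2 y : B y -> mu.-integrable A (fun x => (F x y)%:E).
  move=> By; apply: measurable_bounded_integrable => //.
    by apply: measurable_funTS; exact: mF2.
  exists M; split; first exact: num_real.
  move=> K MK x Ax /=; apply: le_trans (ltW MK); apply: bF.
    by move: Ax; rewrite /A /= in_itv.
  by move: By; rewrite /B /= in_itv.
have GA x : (fun y => G (x, y)) = if x \in A then (fun y => (F x y)%:E) \_ B else cst 0.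
  apply/funext => y; rewrite /G /patch in_setX /=.
  by case: (x \in A) => /=; case: (y \in B).
have GB y : (fun x => G (x, y)) = if y \in B then (fun x => (F x y)%:E) \_ A else cst 0.
  apply/funext => x; rewrite /G /patch in_setX /=.
  by case: (y \in B) => /=; case: (x \in A).
have E1 : (fun x => \int[mu]_y G (x, y)) = (fun x => (rint a' b' (F x))%:E) \_ A.
  apply/funext => x; rewrite GA [RHS]/patch; case: ifP => [|_]; last by rewrite integral0.
  rewrite inE => Ax; rewrite -integral_mkcond /rint /Rintegral fineK//.
  exact: integrable_fin_num (iF1 x Ax).
have E2 : (fun y => \int[mu]_x G (x, y)) = (fun y => (rint a b (F^~ y))%:E) \_ B.
  apply/funext => y; rewrite GB [RHS]/patch; case: ifP => [|_]; last by rewrite integral0.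
  rewrite inE => By; rewrite -integral_mkcond /rint /Rintegral fineK//.
  exact: integrable_fin_num (iF2 y By).
have iG : (mu \x mu).-integrable setT G.
  apply/(integrable12ltyP mu mu mG).
  pose H x := ((cst (`|M|%:E * mu B)) \_ A) x.
  apply: (@le_lt_trans _ _ (\int[mu]_x H x)).
    apply: ge0_le_integral => //=.
    - by move=> x _; exact: integral_ge0.
    - apply: (measurable_fun_fubini_tonelli_F (abse \o G)) => //=.
      exact: measurableT_comp.
    - by apply/(measurable_restrictT _ mA); exact: measurable_cst.
    - move=> x _; rewrite /H /patch; case: ifPn => xA; last first.
        rewrite (eq_integral (cst 0)) ?integral0// => y _.
        by have := congr1 (fun g => g y) (GA x); rewrite (negbTE xA) => ->; rewrite abse0.
      rewrite (eq_integral ((fun y => `|(F x y)%:E|) \_ B)); last first.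
        move=> y _; have := congr1 (fun g => g y) (GA x); rewrite xA => ->.
        by rewrite /patch; case: ifP => //; rewrite abse0.
      rewrite -integral_mkcond -integral_cst//; apply: ge0_le_integral => //.
      + by apply: measurable_funTS; apply: measurableT_comp => //; exact/measurable_EFinP.
      + move=> y By; rewrite lee_fin (le_trans _ (ler_norm M))//; apply: bF.
          by move: xA; rewrite inE /A /= in_itv.
        by move: By; rewrite /B /= in_itv.
  rewrite -integral_mkcond integral_cst//.
  by rewrite lte_mul_pinfty ?mule_ge0// ge0_fin_numE ?mule_ge0// lte_mul_pinfty.
split.
- rewrite -/A -[A]setTI; apply/(integrable_restrict _ mA) => //.
  by rewrite -E1; exact: integrable_fubini_F iG.
- apply: measurable_bounded_integrable => //.
    apply/measurable_EFinP/(measurable_restrictT _ mB).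
    by rewrite -E2; exact: measurable_fubini_G iG.
  exists (M * fine (mu A))%R; split; first exact: num_real.
  move=> K MK y By /=; apply: le_trans (ltW MK).
  apply: (le_trans (le_normr_Rintegral mA (iF2 y By))).
  rewrite -Rintegral_cst//; apply: le_Rintegral => //.
  - exact: integrable_norm (iF2 y By).
  - by apply: measurable_bounded_integrable => //; exact: bounded_cst.
  - move=> x Ax; apply: bF; first by move: Ax; rewrite /A /= in_itv.
    by move: By; rewrite /= in_itv.
- have := Fubini iG; rewrite E1 E2 -!integral_mkcond => h.
  by rewrite /rint [LHS]/Rintegral [RHS]/Rintegral h.
Qed.

End Fubini.

(** * Zeroes of the derivatives *)

Section KernelLowerBound.
Variable R : realType.
Local Notation C := (R[i]).
Implicit Types (x t xi : R) (m n : nat).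

Lemma ker_rescale m (be : C) (u t : R) : 0 < u ->
  ker m be 1 (t / u) = ker m ((u ^+ m)%:C%C * be) u t.
Proof.
move=> u0; rewrite /ker; congr Re.
have -> : kv 1 (t / u) = u%:C%C * kv u t.
  have e : Complex u t = u%:C%C * Complex 1 (t / u).
    by apply/eqP; rewrite eq_complex /=; apply/andP; split; apply/eqP; field; rewrite gt_eqF.
  rewrite /kv e invfM mulrA mulfV ?mul1r//.
  by apply/eqP => -[/eqP]; rewrite gt_eqF.
by rewrite exprMn -rmorphXn mulrA [be * _]mulrC.
Qed.

Lemma kv1_sub t : 1 - kv 1 t = ic R * t%:C%C * kv 1 t.
Proof.
have h := kv_mul t (ltr01 : 0 < 1 :> R).
rewrite -[X in X - _]h -[X in _ - X]mul1r -mulrBl; congr (_ * _).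
by apply/eqP; rewrite eq_complex /=; apply/andP; split; apply/eqP; ring.
Qed.

Lemma normc_kv1_le1 t : normc (kv 1 t) <= 1.
Proof. by have := normc_kv t (ltr01 : 0 < 1 :> R); rewrite invr1. Qed.

Lemma normc_add z w : normc (z + w : C) <= normc z + normc w.
Proof. exact: le_normcD. Qed.

Lemma normc_1_sub_kvX m t : normc (1 - kv 1 t ^+ m) <= m%:R * `|t|.
Proof.
elim: m => [|m IH]; first by rewrite expr0 subrr normc0 mul0r.
have -> : 1 - kv 1 t ^+ m.+1 = (1 - kv 1 t ^+ m) + kv 1 t ^+ m * (1 - kv 1 t).
  by rewrite exprSr; ring.
apply: (le_trans (normc_add _ _)); rewrite -natr1 mulrDl lerD// mul1r.
rewrite kv1_sub !normcM normcX normc_ic mul1r normc_real mulrCA ler_piMr//.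
by rewrite mulr_ile1 ?exprn_ge0 ?normc_ge0 ?exprn_ile1 ?normc_kv1_le1 ?normc_ge0.
Qed.

Lemma ker_le1 m t : ker m 1 1 t <= 1.
Proof.
rewrite (le_trans (ler_norm _))// (le_trans (ker_abs _ _ _ _))//.
by rewrite normc1 invr1 expr1n mulr1.
Qed.

(** Let [w = kv 1 xi]. From [|w^m| <= 1] one gets [|1 - w^m|^2 <= 2 (1 - Re (w^m))]. Moreover
    [1 - w^m] is [i xi] times a sum of [m] powers of [w], each with real part at least 1/2 because
    [m |xi| <= 1/2]; so [|1 - w^m| >= m |xi| / 2]. *)
Lemma ker_lower m xi : m%:R * `|xi| <= 2^-1 ->
  (m%:R * xi) ^+ 2 / 8 <= 1 - ker m 1 1 xi.
Proof.
move=> mxi; set w := kv 1 xi.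
have hw k : (k <= m)%N -> 2^-1 <= Re (w ^+ k).
  move=> km; have : `|Re (1 - w ^+ k)| <= 2^-1.
    apply: (le_trans (Re_le_normc _)); apply: (le_trans (normc_1_sub_kvX _ _)).
    by apply: le_trans mxi; rewrite ler_wpM2r// ler_nat.
  by rewrite Re_sub ler_norml => /andP[_] /=; lra.
have E j : 1 - w ^+ j = ic R * xi%:C%C * \sum_(k < j) w ^+ k.+1.
  elim: j => [|j IH]; first by rewrite expr0 subrr big_ord0 mulr0.
  rewrite big_ord_recr /= mulrDr -IH.
  have := kv1_sub xi; rewrite -/w => h.
  by rewrite exprS mulrA -h; ring.
have S0 j : (j <= m)%N -> j%:R / 2 <= Re (\sum_(k < j) w ^+ k.+1).
  elim: j => [|j IH] jm; first by rewrite big_ord0 mul0r.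
  rewrite big_ord_recr /= Re_add -natr1 mulrDl mul1r lerD ?IH ?(ltnW jm)//.
  exact: hw.
have nS : m%:R / 2 <= normc (\sum_(k < m) w ^+ k.+1).
  apply: (le_trans (S0 m (leqnn m))); apply: le_trans (Re_le_normc _).
  exact: ler_norm.
have n1 : m%:R * `|xi| / 2 <= normc (1 - w ^+ m).
  rewrite E !normcM normc_ic mul1r normc_real mulrAC mulrC.
  by rewrite ler_wpM2l.
have sq : normc (1 - w ^+ m) ^+ 2 <= 2 * (1 - Re (w ^+ m)).
  have : normc (w ^+ m) ^+ 2 <= 1.
    by rewrite expr_le1 ?normc_ge0// normcX exprn_ile1 ?normc_ge0 ?normc_kv1_le1.
  by rewrite !normc_sqr; case: (w ^+ m) => p q /=; nra.
have : (m%:R * `|xi| / 2) ^+ 2 <= normc (1 - w ^+ m) ^+ 2.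
  by rewrite lerXn2r ?nnegrE ?normc_ge0// !mulr_ge0.
move=> /le_trans /(_ sq); rewrite !exprMn real_normK ?num_real// exprVn.
by rewrite /ker mul1r -/w; lra.
Qed.

(* Integrating the kernel over the dilation [tau] yields a function of [X] which,
   by [kavgE], has the sign of [X]. *)
Definition kavg m (t1 X : R) : R :=
  rint 0 t1 (fun tau => ker m.+1 (ic R) 1 (X / m.+1%:R * tau)).

(** By [is_derive_ker] the integrand is a multiple of the derivative in [tau] of [ker m 1 1], so the
    average has a closed form. The sign follows from [ker m 1 1 <= 1]. *)
Lemma kavgE m t1 X : (0 < m)%N -> 0 <= t1 ->
  X * kavg m t1 X = m.+1%:R / m%:R * (1 - ker m 1 1 (X / m.+1%:R * t1)).
Proof.
move=> m0 t10; rewrite /kavg.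
pose k := X / m.+1%:R.
have M0 : m%:R != 0 :> R by rewrite pnatr_eq0 -lt0n.
have M1 : m.+1%:R != 0 :> R by rewrite pnatr_eq0.
have dk (j : nat) (be : C) x : is_derive x (1 : R) (fun tau => ker j be 1 (k * tau))
   (k * ker j.+1 (- ic R * be * j%:R) 1 (k * x)).
  rewrite (_ : (fun tau => _) = (fun tau => ker j be 1 (k * tau + 0))); last first.
    by apply/funext => y; rewrite addr0.
  by rewrite -[k * x]addr0; apply: is_derive_affine; exact: is_derive_ker.
have ck j be : continuous (fun tau => ker j be 1 (k * tau)).
  exact: is_derive_continuous (dk j be).
have := rint_FTC t10 (continuous_scale (ck m.+1 (- ic R * 1 * m%:R)) (k := k)) (dk m 1).
rewrite mulr0.
have -> : ker m 1 1 (0 : R) = 1.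
  rewrite /ker mul1r.
  have -> : kv 1 0 = 1 :> C.
    have := kv_mul (0 : R) ltr01; have -> : Complex 1 0 = 1 :> C by [].
    by rewrite mul1r.
  by rewrite expr1n.
have -> : (fun x => k * ker m.+1 (- ic R * 1 * m%:R) 1 (k * x)) =
   (fun x => - (k * m%:R) * ker m.+1 (ic R) 1 (k * x)).
  apply/funext => x; set z := k * x.
  have -> : ker m.+1 (- ic R * 1 * m%:R) 1 z = - m%:R * ker m.+1 (ic R) 1 z.
    have -> : - ic R * 1 * m%:R = (- m%:R)%:C%C * ic R.
      by rewrite rmorphN rmorph_nat; ring.
    by rewrite /ker -mulrA Re_scale.
  by ring.
rewrite rintZ// => h.
have -> : X = k * m.+1%:R by rewrite /k divfK.
have -> : k * m.+1%:R / m.+1%:R * t1 = k * t1 by field.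
have -> : k * m.+1%:R * rint 0 t1 (fun tau => ker m.+1 (ic R) 1 (k * m.+1%:R / m.+1%:R * tau)) =
  m.+1%:R / m%:R * - (- (k * m%:R) * rint 0 t1 (fun x => ker m.+1 (ic R) 1 (k * x))).
  rewrite mulrK ?unitfE//; field; exact: M0.
by rewrite h opprB.
Qed.

End KernelLowerBound.

(** * Upper and lower bounds for a unimodal function *)

Section RootBound.
Variables (R : realType) (f : R -> R) (c : R).
Local Notation C := (R[i]).
Implicit Types (be : C).
Hypothesis bf : bell_shaped f.
Hypothesis fl : forall x, x <= c -> 0 <= derive1n 1 f x.
Hypothesis fr : forall x, c <= x -> derive1n 1 f x <= 0.

Let sf : smooth f. Proof. by case: bf. Qed.
Let f0 x : 0 <= f x. Proof. by case: bf. Qed.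
Let df x : is_derive x (1 : R) f (derive1n 1 f x).
Proof. exact: (@smooth_is_derive R f 0 x sf). Qed.
Let cf : continuous f. Proof. exact: (@smooth_continuous R f 0 sf). Qed.
Let cf1 : continuous (derive1n 1 f). Proof. exact: smooth_continuous. Qed.

(** Outside [[c - r0, c + r0]] the function is monotone and nonnegative, so its variation there is
    at most [f (c + r0) + f (c - r0)]. *)
Lemma fker_tail n (r0 r u : R) be : 0 < u -> 0 <= r0 -> r0 <= r ->
  `|fker f c n r be u - fker f c n r0 be u| <=
    normc be * u^-1 ^+ n.+1 * (f (c + r0) + f (c - r0)).
Proof.
move=> u0 r00 r0r.
have cF : continuous (fun x => derive1n 1 f x * ker n.+1 be u (x - c)).
  by apply: continuous_mul => //; exact: continuous_ker.
rewrite /fker /crint (@rint_split _ (c - r) (c - r0) (c + r))//; try lra.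
rewrite (@rint_split _ (c - r0) (c + r0) (c + r))//; try lra.
set K := normc be * _; have K0 : 0 <= K.
  by rewrite mulr_ge0 ?normc_ge0// exprn_ge0// invr_ge0 ltW.
have kb x : `|ker n.+1 be u (x - c)| <= K by exact: ker_abs.
have h1 : `|rint (c - r) (c - r0) (fun x => derive1n 1 f x * ker n.+1 be u (x - c))| <=
    K * f (c - r0).
  apply: (@le_trans _ _ (rint (c - r) (c - r0) (fun x => K * derive1n 1 f x))).
    apply: rint_abs => //; first exact: continuous_scale.
    move=> x /andP[_ xr]; rewrite normrM ger0_norm; last by apply: fl; lra.
    by rewrite mulrC ler_wpM2r// fl//; lra.
  rewrite rintZ// (rint_FTC _ cf1 df); last by lra.
  by rewrite ler_wpM2l// lerBlDr lerDl.
have h2 : `|rint (c + r0) (c + r) (fun x => derive1n 1 f x * ker n.+1 be u (x - c))| <=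
    K * f (c + r0).
  apply: (@le_trans _ _ (rint (c + r0) (c + r) (fun x => - K * derive1n 1 f x))).
    apply: rint_abs => //; first exact: continuous_scale.
    move=> x /andP[xr _]; rewrite normrM ler0_norm; last by apply: fr; lra.
    rewrite mulrC -[leRHS]mulrNN opprK ler_wpM2r// oppr_ge0 fr//; lra.
  rewrite rintZ// (rint_FTC _ cf1 df); last by lra.
  by rewrite mulNr -mulrN ler_wpM2l// opprB lerBlDr lerDl.
move: h1 h2; set I1 := rint (c - r) _ _; set I2 := rint (c + r0) _ _; set I0 := rint _ _ _.
move=> h1 h2; rewrite (_ : I1 + (I0 + I2) - I0 = I2 + I1); last by ring.
by rewrite mulrDr; apply: le_trans (ler_normD _ _) _; rewrite lerD.
Qed.

(** On [[c - r0, c + r0]] the derivative is moved to the kernel, which produces the factor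
    [n.+1 / u], that is [t] when [u = n.+1 / t]. The boundary terms and the tail each contribute one
    copy of [f (c + r0) + f (c - r0)]. *)
Lemma fker_bound n (r0 r u M : R) be : 0 < u -> 0 <= r0 -> r0 <= r -> crint c r0 f <= M ->
  `|fker f c n r be u| <=
    normc be * u^-1 ^+ n.+1 * (2 * (f (c + r0) + f (c - r0)) + n.+1%:R / u * M).
Proof.
move=> u0 r00 r0r fM.
have ab : c - r0 <= c + r0 by lra.
have dk x : is_derive x (1 : R) (fun x => ker n.+1 be u (x - c))
    (ker n.+2 (- ic R * be * n.+1%:R) u (x - c)).
  by apply: is_derive_shift; exact: is_derive_ker.
have ck := @continuous_ker R c n.+2 (- ic R * be * n.+1%:R) u u0.
set K := normc be * u^-1 ^+ n.+1.
have K0 : 0 <= K.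
  by rewrite mulr_ge0 ?normc_ge0// exprn_ge0// invr_ge0 ltW.
have kb x : `|ker n.+1 be u x| <= K by exact: ker_abs.
have K2 : 0 <= K * (n.+1%:R / u) by rewrite mulr_ge0// divr_ge0// ltW.
have h : `|fker f c n r0 be u| <= K * (f (c + r0) + f (c - r0)) + K * (n.+1%:R / u) * M.
  rewrite /fker /crint (rint_by_parts ab cf1 ck df dk).
  apply: (le_trans (ler_normB _ _)); apply: lerD.
    apply: (le_trans (ler_normB _ _)); rewrite mulrDr.
    rewrite !normrM !(ger0_norm (f0 _)) [K * f _]mulrC [K * f _]mulrC.
    by apply: lerD; apply: ler_wpM2l.
  apply: (@le_trans _ _ (rint (c - r0) (c + r0) (fun x => K * (n.+1%:R / u) * f x))).
    apply: rint_abs; [exact: continuous_mul|exact: continuous_scale|].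
    move=> x _; rewrite normrM (ger0_norm (f0 _)) mulrC ler_wpM2r//.
    apply: (le_trans (ker_abs _ _ _ u0)); rewrite /K.
    rewrite -[n.+1%:R in leLHS](rmorph_nat (real_complex R)) !normcM normc_real.
    rewrite ger0_norm// normcN normc_ic mul1r [in leLHS]exprSr le_eqVlt.
    by apply/orP; left; apply/eqP; ring.
  by rewrite rintZ// ler_wpM2l.
have t := @fker_tail n r0 r u be u0 r00 r0r.
rewrite -[fker f c n r be u](subrK (fker f c n r0 be u)).
apply: (le_trans (ler_normD _ _)); apply: (le_trans (lerD t h)).
by rewrite le_eqVlt; apply/orP; left; apply/eqP; rewrite -/K; ring.
Qed.

(** The average has the sign of [x - c] and [f'] has the opposite one, so the product is nowhere
    positive. The length [(2 l)^-1] of the averaging interval puts all [|x - c| <= l] in the range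
    of [ker_lower]; the 16 is the 8 of that lemma and [m / (m + 1) >= 1/2]. *)
Lemma kavg_pointwise m (l x : R) : (0 < m)%N -> 0 < l ->
  derive1n 1 f x * kavg m (2 * l)^-1 (x - c) <=
  if `|x - c| <= l then ((2 * l)^-1) ^+ 2 / 16 * (derive1n 1 f x * (x - c)) else 0.
Proof.
move=> m0 l0; set t1 := (2 * l)^-1; set X := x - c.
have t10 : 0 < t1 by rewrite invr_gt0 mulr_gt0.
have Z := kavgE X m0 (ltW t10); set k := kavg _ _ _ in Z *.
have M0 : 0 < m%:R :> R by rewrite ltr0n.
have M1 : 0 < m.+1%:R :> R by rewrite ltr0n.
have Z0 : 0 <= X * k.
  by rewrite Z; apply: mulr_ge0 (divr_ge0 (ltW M1) (ltW M0)) _; rewrite subr_ge0 ker_le1.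
have Zl : `|X| <= l -> X * (t1 ^+ 2 / 16 * X) <= X * k.
  move=> Xl; rewrite Z.
  have mM : m%:R / m.+1%:R <= 1 :> R by rewrite ler_pdivrMr// mul1r ler_nat.
  have mM2 : 2^-1 <= m%:R / m.+1%:R :> R.
    rewrite ler_pdivlMr// -[m.+1%:R]natr1; have : 1 <= m%:R :> R by rewrite ler1n.
    by lra.
  have hx : m%:R * `|X / m.+1%:R * t1| <= 2^-1.
    rewrite !normrM normfV [`|t1|]ger0_norm ?(ltW t10)// [`|m.+1%:R|]ger0_norm ?(ltW M1)//.
    rewrite (_ : _ * _ = (m%:R / m.+1%:R) * (`|X| * t1)); last by field; rewrite gt_eqF.
    have : `|X| * t1 <= 2^-1.
      by rewrite /t1 ler_pdivrMr ?mulr_gt0// mulrA mulVf ?mul1r.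
    move=> h; apply: le_trans h; by rewrite ler_piMl// mulr_ge0// ltW.
  have := ler_wpM2l (divr_ge0 (ltW M1) (ltW M0)) (ker_lower hx).
  apply: le_trans.
  rewrite (_ : m.+1%:R / m%:R * _ = (m%:R / m.+1%:R) * ((X * t1) ^+ 2 / 8)); last first.
    by field; rewrite !gt_eqF.
  have : 2^-1 * ((X * t1) ^+ 2 / 8) <= (m%:R / m.+1%:R) * ((X * t1) ^+ 2 / 8).
    by rewrite ler_wpM2r// divr_ge0// sqr_ge0.
  apply: le_trans; rewrite le_eqVlt; apply/orP; left; apply/eqP; by field.
have [Xc|Xc|Xc] := ltgtP x c; last first.
- have f10 : derive1n 1 f x = 0 by apply/eqP; rewrite eq_le fl ?fr// Xc.
  by rewrite f10 !mul0r mulr0; case: ifP.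
- have X0 : 0 < X by rewrite subr_gt0.
  have g0 := fr (ltW Xc).
  have k0 : 0 <= k by rewrite -(pmulr_rge0 _ X0).
  case: ifP => [/Zl h|_]; last by rewrite mulr_le0_ge0.
  by rewrite [leRHS]mulrCA ler_wnM2l// -(ler_pM2l X0).
- have X0 : X < 0 by rewrite subr_lt0.
  have g0 := fl (ltW Xc).
  have k0 : k <= 0 by rewrite -(nmulr_rge0 _ X0).
  case: ifP => [/Zl h|_]; last by rewrite mulr_ge0_le0.
  by rewrite [leRHS]mulrCA ler_wpM2l// -(ler_nM2l X0).
Qed.

(** By parts, the integral of [f'(x) (x - c)] over [[c - l, c + l]] is [l (f (c + l) + f (c - l))]
    minus the integral of [f]. *)
Lemma crint_le0_part (k l r : R) (h : R -> R) : l <= r -> 0 <= l ->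
  (@lebesgue_measure R).-integrable `[c - r, c + r] (EFin \o h) ->
  (forall x, h x <= if `|x - c| <= l then k * (derive1n 1 f x * (x - c)) else 0) ->
  crint c r h <= - (k * (crint c l f - l * (f (c + l) + f (c - l)))).
Proof.
move=> lr l0 ih hle.
pose A : set (measurableTypeR R) := `[c - l, c + l]%classic.
pose g x := k * (derive1n 1 f x * (x - c)).
have cx : continuous (fun x => x - c).
  by apply: continuous_sub => x; [exact: cvg_id|exact: cvg_cst].
have cfx : continuous (fun x => derive1n 1 f x * (x - c)) by exact: continuous_mul.
have cg : continuous g by exact: continuous_scale.
have mA : measurable A by exact: measurable_itv.
have AD : `[c - r, c + r]%classic `&` A = A.
  apply/setIidr => x /=; rewrite /A /= !in_itv /= => /andP[? ?].
  by apply/andP; split; lra.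
apply: (@le_trans _ _ (crint c r (g \_ A))).
  rewrite /crint /rint; apply: le_Rintegral => //.
    rewrite -restrict_EFin; apply/(integrable_restrict _ mA) => //.
    by rewrite AD; exact: rint_integrable.
  move=> x _; apply: (le_trans (hle x)); rewrite /patch mem_setE /A in_itv /=.
  rewrite (_ : (c - l <= x <= c + l) = (`|x - c| <= l)) //.
  by rewrite ler_norml; apply/idP/idP => /andP[? ?]; apply/andP; split; lra.
rewrite /crint /rint -Rintegral_mkcondr AD -/(rint _ _ g) rintZ//.
have d1 x : is_derive x (1 : R) (fun x => x - c) 1.
  exact: is_derive_shift (is_derive_id _ _).
have c1 : continuous (fun _ : R => 1 : R) by move=> x; exact: cvg_cst.
rewrite (rint_by_parts _ cf1 c1 df d1); last by lra.
rewrite (_ : (fun x => f x * 1) = f); last by apply/funext => x; rewrite mulr1.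
rewrite -/(rint (c - l) (c + l) f).
by rewrite le_eqVlt; apply/orP; left; apply/eqP; ring.
Qed.

End RootBound.

Section FkerAverage.
Variables (R : realType) (f : R -> R) (c : R).
Local Notation C := (R[i]).
Hypothesis bf : bell_shaped f.
Hypothesis fl : forall x, x <= c -> 0 <= derive1n 1 f x.
Hypothesis fr : forall x, c <= x -> derive1n 1 f x <= 0.

Let sf : smooth f. Proof. by case: bf. Qed.
Let cf1 : continuous (derive1n 1 f). Proof. exact: smooth_continuous. Qed.

Lemma continuous_dilate (k : R) (h : R -> R) : continuous h -> continuous (fun x => h (k * x)).
Proof.
move=> ch x; apply: (@continuous_comp _ _ _ (fun x => k * x) h); last exact: ch.
by apply: cvgM; [exact: cvg_cst|exact: cvg_id].
Qed.

(** At [u = n.+1 / t] the weight [u^(n + 1) i] makes [fker] equal to minus the imaginary part of the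
    truncated integral of [f'(x) (1 + i (x - c) t / (n + 1))^(- n - 1)]. Exchanging the integrals
    turns its average over [t] into the integral of [f' kavg], which is negative by a definite
    amount; a lower bound [- D] for all [t] caps this amount. *)
Lemma fker_average n (l r D : R) : (0 < n)%N -> 0 < l -> l <= r -> 0 <= D ->
  (forall t, 0 < t <= (2 * l)^-1 ->
    - D <= fker f c n r (((n.+1%:R / t) ^+ n.+1)%:C%C * ic R) (n.+1%:R / t)) ->
  (2 * l)^-1 / 16 * (crint c l f - l * (f (c + l) + f (c - l))) <= D.
Proof.
move=> n0 l0 lr D0; set t1 := (2 * l)^-1 => hD.
have t10 : 0 < t1 by rewrite invr_gt0 mulr_gt0.
have C1 := rint_cst (- D) (ltW t10); rewrite subr0 in C1.
have N0 : 0 < n.+1%:R :> R by rewrite ltr0n.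
pose k y : R := ker n.+1 (ic R) 1 y.
have ck : continuous k.
  by apply: is_derive_continuous => y; exact: is_derive_ker.
pose F x t : R := derive1n 1 f x * k ((x - c) / n.+1%:R * t).
have LP t : 0 <= t <= t1 -> - D <= rint (c - r) (c + r) (F^~ t).
  move=> /andP[t0 tt].
  (* The endpoint [t = 0] corresponds to no height; the kernel is [Re i = 0] there. *)
  move: t0; rewrite le_eqVlt => /predU1P[<-|t0].
    rewrite (_ : F^~ 0 = fun=> 0).
      by rewrite rint_cst ?mul0r ?oppr_le0//; lra.
    apply/funext => x; rewrite /F mulr0 /k /ker.
    have -> : kv 1 0 = 1 :> C.
      by have := kv_mul (0 : R) ltr01; have -> : Complex 1 0 = 1 :> C by []; rewrite mul1r.
    by rewrite expr1n mulr1 mulr0.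
  apply: le_trans (hD t _) _; first by rewrite t0.
  rewrite /fker /crint le_eqVlt; apply/orP; left; apply/eqP; congr rint.
  apply/funext => x; rewrite /F /k -(ker_rescale _ _ _ (divr_gt0 N0 t0)); congr (_ * ker _ _ _ _).
  by field; rewrite !gt_eqF.
have mF : measurable_fun setT (fun z : measurableTypeR R * measurableTypeR R => F z.1 z.2).
  apply: measurable_funM.
    apply: (measurableT_comp (continuous_measurable_fun cf1)).
    exact: measurable_fst.
  apply: (measurableT_comp (continuous_measurable_fun ck)).
  apply: measurable_funM => //; apply: measurable_funM => //.
  by apply: measurable_funB.
have [M hM] : exists M, forall x, c - r <= x <= c + r -> `|derive1n 1 f x| <= M.
  have [||z _ hz] := @EVT_max R (fun x => `|derive1n 1 f x|) (c - r) (c + r).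
  - by lra.
  - by apply: continuous_subspaceT => x; apply: cvg_norm; exact: cf1.
  by exists `|derive1n 1 f z| => x xI; apply: hz; rewrite in_itv.
have bF x t : c - r <= x <= c + r -> 0 <= t <= t1 -> `|F x t| <= M.
  move=> /hM h _; rewrite /F normrM -[M]mulr1 ler_pM//.
  apply: (le_trans (ker_abs _ _ _ _)) => //.
  by rewrite normc_ic invr1 expr1n mulr1.
have [i1 i2 E] := rint_fubini mF bF.
have FE x : rint 0 t1 (F x) = derive1n 1 f x * kavg n t1 (x - c).
  exact: (rintZ _ _ _ (@continuous_dilate ((x - c) / n.+1%:R) k ck)).
have U : crint c r (fun x => rint 0 t1 (F x)) <=
    - (t1 ^+ 2 / 16 * (crint c l f - l * (f (c + l) + f (c - l)))).
  apply: (crint_le0_part bf lr (ltW l0) i1) => x.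
  by rewrite FE; exact: (kavg_pointwise fl fr).
have L : - D * t1 <= rint 0 t1 (fun t => rint (c - r) (c + r) (F^~ t)).
  rewrite -C1; apply: (le_Rintegral _ _ i2); first exact: measurable_itv.
    by apply: rint_integrable => y; exact: cvg_cst.
  by move=> t /=; rewrite in_itv; exact: LP.
move: U; rewrite /crint E => /(le_trans L).
rewrite mulNr lerN2 expr2 -!mulrA mulrC ler_pM2r// .
Qed.

End FkerAverage.

Section RootsBounded.
Variables (R : realType) (f : R -> R) (c : R).
Local Notation C := (R[i]).
Hypothesis bf : bell_shaped f.
Hypothesis fl : forall x, x <= c -> 0 <= derive1n 1 f x.
Hypothesis fr : forall x, c <= x -> derive1n 1 f x <= 0.

Lemma roots_bounded n (s : seq R) (sg l r0 t2 eps M : R) :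
  (0 < n)%N -> (size s <= n.+1)%N -> sg = 1 \/ sg = -1 ->
  (forall x, 0 <= sg * derive1n n.+1 f x * \prod_(b <- s) (b - x)) ->
  0 < l -> l <= r0 -> 0 < t2 -> 0 < eps -> 0 <= M ->
  f (c + r0) + f (c - r0) <= eps -> crint c r0 f <= M ->
  2 * (2 * eps + t2 * M) + 2 * eps <
    (2 * l)^-1 / 16 * (crint c l f - l * (f (c + l) + f (c - l))) ->
  forall b, b \in s -> `|b - c| < n.+1%:R / t2.
Proof.
move=> n0 sn sgE gs l0 lr t20 eps0 M0 feps fM hD b bs.
rewrite ltNge; apply/negP => ub.
have r00 : 0 <= r0 by lra.
have N0 : 0 < n.+1%:R :> R by rewrite ltr0n.
set u2 := n.+1%:R / t2 in ub.
have u20 : 0 < u2 by rewrite divr_gt0.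
(* The first term is the bound at [t2] times the price 2 of a far root. Of the other [2 * eps], one
   [eps] is for the limit in [fker_compare] and one for the tail. *)
set D := 2 * _ + _ in hD.
have tM0 : 0 <= t2 * M by rewrite mulr_ge0// ltW.
have D0 : 0 <= D by rewrite /D; lra.
move: hD; rewrite ltNge => /negP; apply.
apply: (fker_average bf fl fr n0 l0 lr D0) => t /andP[t0 _].
set u := n.+1%:R / t; have u0 : 0 < u by rewrite divr_gt0.
have nbe (k : R) : `|k| = 1 -> normc (k%:C%C * ((u ^+ n.+1)%:C%C * ic R)) * u^-1 ^+ n.+1 = 1.
  move=> k1; rewrite !normcM !normc_real k1 mul1r normc_ic mulr1.
  rewrite ger0_norm ?exprn_ge0 ?(ltW u0)// -exprMn mulfV ?expr1n//.
  by rewrite gt_eqF.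
have nbe1 : normc ((u ^+ n.+1)%:C%C * ic R) * u^-1 ^+ n.+1 = 1.
  by rewrite -[RHS](nbe 1 (normr1 _)); congr (normc _ * _); rewrite rmorph1 mul1r.
have Nu : n.+1%:R / u = t by rewrite /u invf_div mulrCA divff ?mulr1// gt_eqF.
have [tt2|t2t] := leP t t2.
  have := fker_bound bf fl fr n ((u ^+ n.+1)%:C%C * ic R) u0 r00 (lexx r0) fM.
  rewrite nbe1 mul1r Nu ler_norml => /andP[+ _]; apply: le_trans.
  rewrite lerN2 /D; have := ler_wpM2r M0 tt2; lra.
have uu2 : u <= u2 by rewrite ler_pM2l// lef_pV2// ltW.
pose d := u2^-1 ^+ n.+1 * (2 * eps + t2 * M).
have d0 : 0 <= d by rewrite mulr_ge0 ?exprn_ge0 ?invr_ge0 ?(ltW u20)//; lra.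
have hd : exists B, forall r, B <= r -> forall be, `|fker f c n r be u2| <= d * normc be.
  exists r0 => r r0r be.
  apply: (le_trans (fker_bound bf fl fr n be u20 r00 r0r fM)).
  have -> : n.+1%:R / u2 = t2 by rewrite /u2 invf_div mulrCA divff ?mulr1// gt_eqF.
  rewrite /d -mulrA mulrC ler_wpM2r ?normc_ge0//.
  by rewrite ler_wpM2l ?exprn_ge0 ?invr_ge0 ?(ltW u20)// lerD2r ler_wpM2l.
have q1 : 1 <= u2 / u by rewrite ler_pdivlMr// mul1r.
have hq : normc (pis c u2 s) * (u2 / u) <= 2 * (u2 / u) ^+ n.+1 * normc (pis c u s).
  apply: (le_trans (normc_pis_far u0 uu2 bs ub)).
  by rewrite ler_wpM2r ?normc_ge0// ler_wpM2l// ler_weXn2l.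
(* The factor [- sg] turns the upper bound on [sg * fker] into the desired lower bound. *)
pose be := (- sg)%:C%C * ((u ^+ n.+1)%:C%C * ic R).
have [B hB] := fker_compare bf sn sgE gs be u0 uu2 d0 hd hq eps0.
(* The comparison holds for large radii only; [fker_tail] then returns to the radius [r0] at which
   the average is taken. *)
have := hB (Num.max B r0); rewrite le_max lexx /= => /(_ isT).
have r0m : r0 <= Num.max B r0 by rewrite le_max lexx orbT.
have := fker_tail bf fl fr n ((u ^+ n.+1)%:C%C * ic R) u0 r00 r0m.
rewrite nbe1 mul1r /be fker_scale// mulrA.
have -> : sg * - sg = -1 by case: sgE => ->; ring.
rewrite mulN1r -/be; set r := Num.max _ _.
(* All powers cancel: [d] carries [u2^(- n - 1)], the ratio of the values of [P] carries
   [(u2 / u)^(n + 1)], and [|be| = u^(n + 1)]. *)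
have -> : d * (2 * (u2 / u) ^+ n.+1) * normc be = 2 * (2 * eps + t2 * M).
  have := nbe (- sg); rewrite -/be => /(_ _) h.
  have {}h : normc be * u^-1 ^+ n.+1 = 1.
    by apply: h; case: sgE => ->; rewrite ?normrN ?normrN1 ?normr1.
  have i2 : u2^-1 ^+ n.+1 * u2 ^+ n.+1 = 1.
    by rewrite -exprMn mulVf ?expr1n// gt_eqF.
  rewrite /d exprMn.
  transitivity (2 * (2 * eps + t2 * M) * (u2^-1 ^+ n.+1 * u2 ^+ n.+1) * (normc be * u^-1 ^+ n.+1)).
    by ring.
  by rewrite i2 h !mulr1.
set x := fker _ _ _ r _ _; set y := fker _ _ _ _ _ _.
rewrite ler_norml => /andP[_ h1] h2; rewrite /D; move: h1 h2 feps; clear; lra.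
Qed.

End RootsBounded.

(** * Uniformity over a family *)

Section Uniform.
Variable R : realType.
Implicit Types (f : R -> R).

Definition unimodal f (c : R) :=
  (forall x, x <= c -> 0 <= derive1n 1 f x) /\ (forall x, c <= x -> derive1n 1 f x <= 0).

Lemma bell_shaped_vanish f (e : R) : bell_shaped f -> e = 1 \/ e = -1 ->
  vanishes (fun r => f (e * r)).
Proof.
move=> bf eE; have := bell_shaped_decay 0 0 bf eE.
by apply: vanishes_eq => r; rewrite mul1r addr0.
Qed.

Lemma continuous_root (g : R -> R) (b : R) : continuous g ->
  (forall x, x != b -> 0 <= g x * (b - x)) -> g b = 0.
Proof.
move=> cg gb; apply/eqP; apply: contraT => g0.
have e0 : 0 < `|g b| by rewrite normr_gt0.
have [d /= d0 hd] := (cvgrPdist_lt _ _).1 (cg b) _ e0.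
have hp (y : R) : `|b - y| < d -> `|g b - g y| < `|g b| by move=> h; exact: hd.
have h1 := hp (b + d / 2); have h2 := hp (b - d / 2).
have := gb (b + d / 2); have := gb (b - d / 2).
rewrite (_ : b - (b - d / 2) = d / 2) in h2 *; last by ring.
rewrite (_ : b - (b + d / 2) = - (d / 2)) in h1 *; last by ring.
have d20 : 0 < d / 2 by rewrite divr_gt0.
rewrite !neq_lt ltrBlDr !ltrDl d20 orbT => /(_ isT); rewrite pmulr_lge0// => k2.
move=> /(_ isT); rewrite mulrN oppr_ge0 pmulr_lle0// => k1.
have dd : d / 2 < d by lra.
move: h1 h2; rewrite normrN gtr0_norm// => /(_ dd) h1 /(_ dd) h2.
move: g0; rewrite neq_lt => /orP[gn|gp].
  by move: h2; rewrite (ltr0_norm gn) ltr_norml => /andP[]; lra.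
by move: h1; rewrite (gtr0_norm gp) ltr_norml => /andP[]; lra.
Qed.

Lemma nondecreasing_left f (c : R) : smooth f -> (forall x, x <= c -> 0 <= derive1n 1 f x) ->
  forall x y, x <= y -> y <= c -> f x <= f y.
Proof.
move=> sf fl x y xy yc.
have df z : is_derive z (1 : R) f (derive1n 1 f z) by exact: (@smooth_is_derive R f 0 z sf).
have [z /andP[_ zy] E] := is_derive_MVT df xy.
by rewrite -subr_ge0 E mulr_ge0 ?subr_ge0// fl// (le_trans zy).
Qed.

Lemma nonincreasing_right f (c : R) : smooth f -> (forall x, c <= x -> derive1n 1 f x <= 0) ->
  forall x y, c <= x -> x <= y -> f y <= f x.
Proof.
move=> sf fl x y cx xy.
have df z : is_derive z (1 : R) f (derive1n 1 f z) by exact: (@smooth_is_derive R f 0 z sf).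
have [z /andP[xz _] E] := is_derive_MVT df xy.
by rewrite -subr_le0 E mulr_le0_ge0 ?subr_ge0// fl// (le_trans cx).
Qed.

(** Since [f'] changes sign, its list of roots is a single point [b]. If [f'] were nonpositive
    before [b] and nonnegative after it, [f] would stay above some [f x > 0] up to one of the two
    ends. *)
Lemma bell_shaped_unimodal f : bell_shaped f -> exists c, unimodal f c.
Proof.
move=> bf; have [sf f0 _ _ fn] := bf.
have [s [sg [ss sgE hs]]] := changes_sign_exactly_roots (fn 1%N).
have [[s1 [ss1 _ alt]] _] := fn 1%N.
case: s1 ss1 alt => // x0 [|x1 []]// _ /= /andP[fx01 _].
case: s ss hs => [|b [|//]] _ hs.
  have h x : 0 <= sg * derive1n 1 f x by have := hs x; rewrite big_nil mulr1.
  by have := h x0; have := h x1; case: sgE => -> /=; nra.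
have {}hs x : 0 <= sg * derive1n 1 f x * (b - x) by have := hs x; rewrite big_seq1.
have fb : derive1n 1 f b = 0.
  have : sg * derive1n 1 f b = 0.
    apply: (@continuous_root (fun x => sg * derive1n 1 f x)) => [|x _]; last exact: hs.
    exact: continuous_scale (@smooth_continuous R f 1 sf).
  by case: sgE => ->; rewrite ?mul1r// mulN1r => /eqP; rewrite oppr_eq0 => /eqP.
have hl x : x <= b -> 0 <= sg * derive1n 1 f x.
  rewrite le_eqVlt => /predU1P[->|xb]; first by rewrite fb mulr0.
  by have := hs x; rewrite pmulr_lge0// subr_gt0.
have hr x : b <= x -> sg * derive1n 1 f x <= 0.
  rewrite le_eqVlt => /predU1P[<-|xb]; first by rewrite fb mulr0.
  by have := hs x; rewrite nmulr_lge0// subr_lt0.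
case: sgE => sgE; rewrite sgE in hl hr; exists b.
  by split => x h; [have := hl x h|have := hr x h]; rewrite mul1r.
exfalso.
have [x fx] : exists x, 0 < f x.
  have [fle|] := pselect (forall x, f x <= 0).
    have E : f = cst 0 by apply/funext => x; apply/eqP; rewrite eq_le fle f0.
    by move: fx01; rewrite /= E derive1_cst mul0r ltxx.
  by move=> /existsNP[x /negP]; rewrite -ltNge; exists x.
have v e := @bell_shaped_vanish f e bf.
have fx2 : 0 < f x / 2 by rewrite divr_gt0.
have [xb|bx] := leP x b.
  have [B hB] := v (-1) (or_intror erefl) _ fx2.
  have := hB (Num.max B (- x)); rewrite le_max lexx => /(_ isT); rewrite mulN1r.
  set y := - Num.max _ _; have yx : y <= x by rewrite lerNl le_max lexx orbT.
  have df z : is_derive z (1 : R) f (derive1n 1 f z) by exact: (@smooth_is_derive R f 0 z sf).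
  have [z /andP[_ zx] E] := is_derive_MVT df yx.
  have := hl z (le_trans zx xb); rewrite mulN1r oppr_ge0 => fz.
  have : f x - f y <= 0 by rewrite E mulr_le0_ge0// subr_ge0.
  by rewrite ger0_norm//; lra.
have [B hB] := v 1 (or_introl erefl) _ fx2.
have := hB (Num.max B x); rewrite le_max lexx => /(_ isT); rewrite mul1r.
set y := Num.max _ _; have yx : x <= y by rewrite le_max lexx orbT.
have df z : is_derive z (1 : R) f (derive1n 1 f z) by exact: (@smooth_is_derive R f 0 z sf).
have [z /andP[xz _] E] := is_derive_MVT df yx.
have := hr z (le_trans (ltW bx) xz); rewrite mulN1r oppr_le0 => fz.
have : 0 <= f y - f x by rewrite E mulr_ge0// subr_ge0.
by rewrite ger0_norm//; lra.
Qed.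

Lemma rint_lb f (a b k : R) : a <= b -> continuous f ->
  (forall x, a <= x <= b -> k <= f x) -> k * (b - a) <= rint a b f.
Proof. by move=> ab cf h; rewrite -rint_cst//; apply: rint_le => // x; exact: cvg_cst. Qed.

Lemma rint_ub f (a b k : R) : a <= b -> continuous f ->
  (forall x, a <= x <= b -> f x <= k) -> rint a b f <= k * (b - a).
Proof. by move=> ab cf h; rewrite -rint_cst//; apply: rint_le => // x; exact: cvg_cst. Qed.

End Uniform.

(** * Constants uniform over a class of bell-shaped functions *)

Section UniformBound.
Variable R : realType.
Implicit Types (f : R -> R).
Variables (F : (R -> R) -> Prop) (r1 m0 : R).
Hypothesis r10 : 0 < r1.
Hypothesis m00 : 0 < m0.
Hypothesis Fb : forall f, F f -> bell_shaped f.
Hypothesis Fm : forall f, F f -> m0 <= rint (- r1) r1 f.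
Hypothesis Fe : forall e, 0 < e -> exists rho, forall f, F f ->
  forall x, rho <= `|x| -> rint (x - 1) (x + 1) f <= e.
Hypothesis FM : forall r, 0 <= r -> exists M, forall f, F f -> rint (- r) r f <= M.

Let cF f : F f -> continuous f.
Proof. by move=> /Fb[sf _ _ _ _]; exact: (@smooth_continuous R f 0 sf). Qed.
Let sF f : F f -> smooth f. Proof. by move=> /Fb[]. Qed.
Let f0 f : F f -> forall x, 0 <= f x. Proof. by move=> /Fb[]. Qed.

(** If the mode is far away, [f] is monotone from [[- r1, r1]] up to the mode, so its values on a
    window of length 2 next to the mode dominate those on [[- r1, r1]]. The small mass of the window
    then contradicts [Fm]. *)
Lemma uniform_mode : exists2 rho, 0 <= rho & forall f c, F f -> unimodal f c -> `|c| <= rho.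
Proof.
have r1p := r10; have m0p := m00.
(* With this level, [2 v <= m0 / (2 r1)] and [m0 <= 2 r1 v] give [m0 <= m0 / 2]. *)
have e0 : 0 < m0 / (2 * r1) by rewrite divr_gt0// mulr_gt0.
have [rho hrho] := Fe e0.
exists (Num.max rho r1 + 2); first by rewrite addr_ge0// le_max (ltW r10) orbT.
move=> f c Ff [fl fr]; rewrite leNgt; apply/negP => hc.
have rr1 : rho <= Num.max rho r1 by rewrite le_max lexx.
have rr2 : r1 <= Num.max rho r1 by rewrite le_max lexx orbT.
move: hc; set q := Num.max _ _ in rr1 rr2 * => hc.
have h1 := Fm Ff.
have key (v a : R) : 0 <= v -> rho <= `|a| ->
    (forall y, a - 1 <= y <= a + 1 -> v <= f y) ->
    (forall y, - r1 <= y <= r1 -> f y <= v) -> False.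
  move=> v0 ra hv hy; have h2 := hrho f Ff a ra.
  have a11 : a - 1 <= a + 1 by lra.
  have rr : - r1 <= r1 by have := r10; lra.
  have h3 := rint_lb a11 (cF Ff) hv.
  have h4 := rint_ub rr (cF Ff) hy.
  have h5 : v * 2 <= m0 / (2 * r1) by lra.
  move: h5; rewrite ler_pdivlMr ?mulr_gt0//.
  by have := m00; nra.
have [c0|c0] := leP 0 c.
  rewrite ger0_norm// in hc.
  apply: (key (f r1) (c - 1)).
  - exact: f0.
  - by rewrite ger0_norm; lra.
  - by move=> y /andP[y1 y2]; apply: (nondecreasing_left (sF Ff) fl); lra.
  - by move=> y /andP[y1 y2]; apply: (nondecreasing_left (sF Ff) fl); lra.
rewrite ltr0_norm// in hc.
apply: (key (f (- r1)) (c + 1)).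
- exact: f0.
- by rewrite ltr0_norm; lra.
- by move=> y /andP[y1 y2]; apply: (nonincreasing_right (sF Ff) fr); lra.
- by move=> y /andP[y1 y2]; apply: (nonincreasing_right (sF Ff) fr); lra.
Qed.

(** Beyond all modes [f] is monotone, so [f x] is at most its integral over the adjacent unit
    interval on the side of the mode. *)
Lemma uniform_decay e : 0 < e -> exists2 rho, 0 <= rho & forall f, F f ->
  forall x, rho <= `|x| -> f x <= e.
Proof.
move=> e0; have [q q0 hq] := uniform_mode; have [rho hrho] := Fe e0.
exists (Num.max rho (q + 1)); first by rewrite le_max; apply/orP; right; lra.
move=> f Ff x; rewrite ge_max => /andP[rx qx].
have [c uc] := bell_shaped_unimodal (Fb Ff); have := hq f c Ff uc.
have [fl fr] := uc; rewrite ler_norml => /andP[c1 c2].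
apply: le_trans (hrho f Ff x rx).
have x1 : x - 1 <= x by lra.
have x2 : x <= x + 1 by lra.
have cf := cF Ff; have fp := f0 Ff.
have [x0|x0] := leP 0 x.
  rewrite ger0_norm// in qx.
  have : f x * (x - (x - 1)) <= rint (x - 1) x f.
    apply: rint_lb => // y /andP[y1 y2].
    by apply: (nonincreasing_right (sF Ff) fr); lra.
  rewrite (_ : x - (x - 1) = 1); last by ring.
  by rewrite mulr1 => /le_trans; apply; apply: rint_sub.
rewrite ltr0_norm// in qx.
have : f x * (x + 1 - x) <= rint x (x + 1) f.
  apply: rint_lb => // y /andP[y1 y2].
  by apply: (nondecreasing_left (sF Ff) fl); lra.
rewrite (_ : x + 1 - x = 1); last by ring.
by rewrite mulr1 => /le_trans; apply; apply: rint_sub.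
Qed.

(** On the shells [r <= |x - c| <= l] the function is at least its value at the outer end, which
    compensates all but [r] of the subtracted [l]. The core [[c - r, c + r]] contains
    [[- r1, r1]]. *)
Lemma uniform_excess (q r l : R) f c : F f -> unimodal f c -> `|c| <= q -> r = q + r1 ->
  r <= l -> m0 - r * (f (c + l) + f (c - l)) <= crint c l f - l * (f (c + l) + f (c - l)).
Proof.
move=> Ff [fl fr] cq rE rl; have := Fm Ff; rewrite /crint.
have cf := cF Ff; have fp := f0 Ff.
have q0 : 0 <= q by exact: le_trans cq.
have r1p := r10.
move: cq; rewrite ler_norml => /andP[c1 c2].
rewrite (@rint_split _ (c - l) (c - r) (c + l))//; try lra.
rewrite (@rint_split _ (c - r) (c + r) (c + l))//; try lra.
have a1 : c - l <= c - r by lra.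
have a2 : c + r <= c + l by lra.
have h1 : f (c - l) * (c - r - (c - l)) <= rint (c - l) (c - r) f.
  apply: rint_lb => // y /andP[y1 y2].
  by apply: (nondecreasing_left (sF Ff) fl); lra.
have h2 : f (c + l) * (c + l - (c + r)) <= rint (c + r) (c + l) f.
  apply: rint_lb => // y /andP[y1 y2].
  by apply: (nonincreasing_right (sF Ff) fr); lra.
have h3 : rint (- r1) r1 f <= rint (c - r) (c + r) f by apply: rint_sub => //; lra.
by nra.
Qed.

Lemma uniform_const_sign : exists2 K : R, 0 <= K & forall f n, F f -> (1 <= n)%N ->
  ((forall x, K * n%:R < x -> 0 <= derive1n n f x) \/
   (forall x, K * n%:R < x -> derive1n n f x <= 0)) /\
  ((forall x, x < - (K * n%:R) -> 0 <= derive1n n f x) \/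
   (forall x, x < - (K * n%:R) -> derive1n n f x <= 0)).
Proof.
have r1p := r10; have m0p := m00.
have [q q0 hq] := uniform_mode.
pose r := q + r1.
have rp : 0 < r by rewrite /r; lra.
(* With [f (c + l)] and [f (c - l)] at most [m0 / (4 r)], [uniform_excess] leaves at least
   [m0 / 2]. *)
have e10 : 0 < m0 / (4 * r) by rewrite divr_gt0// mulr_gt0.
have [rho1 rho10 hrho1] := uniform_decay e10.
pose l := r + q + rho1.
have l0 : 0 < l by rewrite /l; lra.
(* [Q] bounds the averaged integral from below. Against it stands [6 eps + 2 t2 |M|], at most
   [Q / 4 + Q / 2] by the choices of [eps] and [t2]. Since [M] depends on the radius [s0], which
   depends on [eps], [t2] comes last. *)
pose Q := (2 * l)^-1 / 16 * (m0 / 2).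
have Q0 : 0 < Q by rewrite mulr_gt0// divr_gt0// invr_gt0 mulr_gt0.
pose eps := Q / 24.
have eps0 : 0 < eps by rewrite divr_gt0.
have [rho2 rho20 hrho2] := uniform_decay (divr_gt0 eps0 (ltr0n _ 2)).
pose s0 := l + rho2 + q.
have s0q : 0 <= s0 + q by rewrite /s0; lra.
have [M hM] := FM s0q.
pose t2 := Q / (4 * (`|M| + 1)).
have M1 : 0 < 4 * (`|M| + 1) by rewrite mulr_gt0// ltr_wpDl.
have t20 : 0 < t2 by rewrite divr_gt0.
have t2M : t2 * `|M| <= Q / 4.
  rewrite /t2 mulrAC ler_pdivrMr//.
  rewrite (_ : Q / 4 * _ = Q * (`|M| + 1)); last by field.
  by apply: ler_wpM2l; [exact: ltW|rewrite lerDl].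
exists (q + t2^-1); first by rewrite addr_ge0// invr_ge0 ltW.
(* For [n = 1] unimodality suffices; [roots_bounded] starts with the second derivative, since
   [kavgE] divides by [m]. *)
move=> f [//|[|n]] Ff _; have [c uc] := bell_shaped_unimodal (Fb Ff).
  have cq := hq f c Ff uc; have [fl fr] := uc; move: cq; rewrite ler_norml => /andP[c1 c2].
  have t2i : 0 <= t2^-1 by rewrite invr_ge0 ltW.
  by rewrite mulr1; split; [right => x hx; apply: fr|left => x hx; apply: fl]; lra.
have cq := hq f c Ff uc; have [fl fr] := uc.
have [sf fp _ _ fn] := Fb Ff.
have [s [sg [ss sgE hs]]] := changes_sign_exactly_roots (fn n.+2).
have cqn := cq; move: cqn; rewrite ler_norml => /andP[c1 c2].
have hf1 (k rho x : R) : (forall f, F f -> forall x, rho <= `|x| -> f x <= k) -> rho + q <= x ->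
    f (c + x) <= k /\ f (c - x) <= k.
  move=> h xx; split; apply: h => //.
    by apply: le_trans (ler_norm _); lra.
  by rewrite -normrN; apply: le_trans (ler_norm _); lra.
have D1 : 2 * (2 * eps + t2 * `|M|) + 2 * eps <
    (2 * l)^-1 / 16 * (crint c l f - l * (f (c + l) + f (c - l))).
  apply: (@lt_le_trans _ _ Q); first by rewrite /eps; lra.
  have rl : r <= l by rewrite /l; lra.
  rewrite /Q ler_wpM2l ?divr_ge0 ?invr_ge0 ?mulr_ge0 ?(ltW l0)//.
  apply: le_trans (uniform_excess Ff uc cq erefl rl).
  have [] := hf1 _ _ l hrho1; first by rewrite /l; lra.
  rewrite -/r !ler_pdivlMr ?mulr_gt0// => h1 h2.
  by nra.
have feps : f (c + s0) + f (c - s0) <= eps.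
  have [] := hf1 _ _ s0 hrho2; first by rewrite /s0; lra.
  by lra.
have hMf : crint c s0 f <= `|M|.
  apply: le_trans (ler_norm _); apply: le_trans (hM f Ff).
  by rewrite /crint; apply: rint_sub => //; [exact: cF|rewrite /s0; lra..].
have ls0 : l <= s0 by rewrite /s0; lra.
have hb := roots_bounded (Fb Ff) fl fr (ltn0Sn n) ss sgE hs l0 ls0 t20 eps0 (normr_ge0 M) feps hMf D1.
have hb2 b : b \in s -> `|b| <= (q + t2^-1) * n.+2%:R.
  move=> /hb /ltW h; rewrite -[b](subrK c); apply: (le_trans (ler_normD _ _)).
  rewrite addrC mulrDl [t2^-1 * _]mulrC; apply: lerD => //.
  by apply: (le_trans cq); rewrite ler_peMr// ler1n.
split.
  apply: roots_const_sign_right sgE hs _ => b /hb2.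
  by apply: le_trans; exact: ler_norm.
apply: roots_const_sign_left sgE hs _ => b /hb2 h.
by rewrite lerNl; apply: le_trans h; rewrite -normrN ler_norm.
Qed.

End UniformBound.

(** * Gaussian smoothing of a weakly bell-shaped measure *)

Section Gauss.
Variable R : realType.
Local Notation TR := (measurableTypeR R).
Local Notation leb := (@lebesgue_measure R).
Local Notation G := (@gauss_kernel R).

Lemma gauss_normal (t x y : R) : 0 < t -> G t (x - y) = normal_pdf y (Num.sqrt (2 * t)) x.
Proof.
move=> t0; have t2 : 0 < 2 * t by rewrite mulr_gt0.
rewrite normal_pdfE ?gt_eqF ?sqrtr_gt0// /gauss_kernel /normal_peak /normal_fun.
rewrite sqr_sqrtr ?(ltW t2)//; congr (_^-1 * _).
  by congr Num.sqrt; rewrite -[_ *+ 2]mulr_natr; ring.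
congr expR; rewrite -mulNr; congr (_ / _).
by rewrite -[_ *+ 2]mulr_natr; ring.
Qed.

Lemma gauss_kernel_ge0 (t x : R) : 0 <= G t x.
Proof. by rewrite mulr_ge0 ?invr_ge0 ?expR_ge0. Qed.

Lemma gauss_kernel_gt0 (t x : R) : 0 < t -> 0 < G t x.
Proof.
by move=> t0; rewrite mulr_gt0 ?expR_gt0// invr_gt0 sqrtr_gt0 !mulr_gt0// pi_gt0.
Qed.

Lemma continuous_gauss_kernel (t : R) : continuous (G t).
Proof.
move=> x; apply: cvgM; first exact: cvg_cst.
apply: (cvg_comp (fun x => - (x ^+ 2 / (4 * t))) expR); last exact: continuous_expR.
apply: cvgN; apply: cvgM; last exact: cvg_cst.
exact: exprn_continuous.
Qed.

Lemma measurable_gauss_kernel (t : R) : measurable_fun setT (G t : TR -> R).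
Proof. exact: continuous_measurable_fun (@continuous_gauss_kernel t). Qed.

Lemma measurable_gauss_kernel2 (t : R) :
  measurable_fun setT (fun z : TR * TR => G t (z.1 - z.2)).
Proof.
apply: (measurableT_comp (measurable_gauss_kernel t)).
exact: measurable_funB.
Qed.

Lemma integral_gauss_kernel (t y : R) : 0 < t -> (\int[leb]_x (G t (x - y))%:E = 1)%E.
Proof.
move=> t0; under eq_integral do rewrite (gauss_normal _ _ t0).
exact: integral_normal_pdf.
Qed.

Lemma integrable_gauss_kernel (t y : R) : 0 < t ->
  leb.-integrable setT (fun x => (G t (x - y))%:E).
Proof.
move=> t0; rewrite (_ : (fun x => _) = (fun x => (normal_pdf y (Num.sqrt (2 * t)) x)%:E)).
  exact: integrable_normal_pdf.
by apply/funext => x; rewrite gauss_normal.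
Qed.

(** The exponent [u^2 / (4 t)] is split as [u^2 / (16 t) + u^2 / (16 t) + u^2 / (8 t)]. The first
    part absorbs [|u|] at the price [2 sqrt t], the second gives a decay independent of [t] as
    [t <= 1], and the third is that of [G_(2 t)]. *)
Lemma gauss_kernel_moment (t u : R) : 0 < t -> t <= 1 ->
  `|u| * G t u <= 4 * Num.sqrt t * (G (2 * t) u * expR (- (u ^+ 2 / 16))).
Proof.
move=> t0 t1; have st : 0 < Num.sqrt t by rewrite sqrtr_gt0.
have tn : t != 0 by rewrite gt_eqF.
have sq : Num.sqrt t ^+ 2 = t by rewrite sqr_sqrtr ?ltW.
rewrite /gauss_kernel.
have -> : expR (- (u ^+ 2 / (4 * t))) =
    expR (- (u ^+ 2 / (16 * t))) * expR (- (u ^+ 2 / (16 * t))) * expR (- (u ^+ 2 / (4 * (2 * t)))).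
  by rewrite -!expRD; congr expR; field.
set e1 := expR (- (u ^+ 2 / (16 * t))); set e2 := expR (- (u ^+ 2 / (4 * _))).
have h1 : `|u| * e1 <= 2 * Num.sqrt t.
  rewrite /e1 expRN ler_pdivrMr ?expR_gt0//.
  have := expR_ge1Dx (u ^+ 2 / (16 * t)).
  have : `|u| <= 2 * Num.sqrt t * (1 + u ^+ 2 / (16 * t)).
    rewrite -[u ^+ 2]real_normK ?num_real// -[in X in _ / X]sq.
    have -> : 2 * Num.sqrt t * (1 + `|u| ^+ 2 / (16 * Num.sqrt t ^+ 2)) =
      2 * Num.sqrt t + `|u| ^+ 2 / (8 * Num.sqrt t) by field; rewrite gt_eqF.
    rewrite -subr_ge0 (_ : _ - _ = (`|u| - 4 * Num.sqrt t) ^+ 2 / (8 * Num.sqrt t)).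
      by rewrite divr_ge0 ?sqr_ge0// mulr_ge0// ltW.
    by field; rewrite gt_eqF.
  by move=> h k; apply: (le_trans h); rewrite ler_wpM2l// mulr_ge0// ltW.
have h2 : e1 <= expR (- (u ^+ 2 / 16)).
  rewrite ler_expR lerN2 ler_pdivlMr ?mulr_gt0// mulrAC ler_pdivrMr//.
  by apply: ler_wpM2l; [exact: sqr_ge0|lra].
have h3 : (Num.sqrt (4 * pi * t))^-1 <= 2 * (Num.sqrt (4 * pi * (2 * t)))^-1.
  have p0 : 0 < 4 * pi * t by rewrite !mulr_gt0// pi_gt0.
  have p1 : 0 < 4 * pi * (2 * t) by rewrite !mulr_gt0// pi_gt0.
  rewrite ler_pdivlMr ?sqrtr_gt0// mulrC ler_pdivrMr ?sqrtr_gt0//.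
  have -> : 2 * Num.sqrt (4 * pi * t) = Num.sqrt (2 ^+ 2 * (4 * pi * t)).
    by rewrite [RHS]sqrtrM ?sqr_ge0// sqrtr_sqr ger0_norm.
  by apply: ler_wsqrtr; lra.
have e20 : 0 <= e2 by exact: expR_ge0.
have e10 : 0 <= e1 by exact: expR_ge0.
rewrite (_ : _ * (_ * _) = (`|u| * e1) * (e1 * ((Num.sqrt (4 * pi * t))^-1 * e2))); last by ring.
rewrite [leRHS](_ : _ = (2 * Num.sqrt t) * (expR (- (u ^+ 2 / 16)) *
  ((2 * (Num.sqrt (4 * pi * (2 * t)))^-1) * e2))); last by ring.
apply: ler_pM => //; rewrite ?mulr_ge0 ?invr_ge0 ?sqrtr_ge0//.
apply: ler_pM => //; rewrite ?mulr_ge0 ?invr_ge0 ?sqrtr_ge0//.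
by rewrite ler_wpM2r.
Qed.

(** A multiple of [G_16] centred at [p], hence integrable against a weakly bell-shaped measure even
    if that has infinite mass. It serves as common weight for the error terms. *)
Definition gwindow (p y : R) : R := expR (- ((y - p) ^+ 2 / 64)).

Lemma gwindowE (p y : R) : gwindow p y = Num.sqrt (4 * pi * 16) * G 16 (p - y).
Proof.
rewrite /gwindow /gauss_kernel mulrA mulfV ?mul1r; last first.
  by rewrite gt_eqF// sqrtr_gt0 !mulr_gt0// pi_gt0.
by congr expR; rewrite -(sqrrN (y - p)) opprB; field.
Qed.

Section Lipschitz.
Variables (h : R -> R) (p K L : R).
Hypothesis K0 : 0 <= K.
Hypothesis L0 : 0 <= L.
Hypothesis hL : forall x y, `|h x - h y| <= L * `|x - y|.
Hypothesis hK : forall x, K <= `|x - p| -> h x = 0.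

(** For [|y - p| <= 2 K] the window is at least [exp (- K^2 / 16)]. For larger [|y - p|] one has
    [h y = 0], so only [x] with [|x - p| < K] matter; then [|x - y| >= |y - p| / 2], and the decay
    in [x - y] becomes the window in [y]. *)
Lemma lipschitz_gauss_pointwise (t x y : R) : 0 < t -> t <= 1 ->
  `|(h x - h y) * G t (x - y)| <=
    4 * L * expR (K ^+ 2 / 16) * Num.sqrt t * gwindow p y * G (2 * t) (x - y).
Proof.
move=> t0 t1; have Kp := K0; have Lp := L0; have m := gauss_kernel_moment (x - y) t0 t1.
have hh : `|(h x - h y) * G t (x - y)| <=
    L * (4 * Num.sqrt t * (G (2 * t) (x - y) * expR (- ((x - y) ^+ 2 / 16)))).
  rewrite normrM (ger0_norm (gauss_kernel_ge0 _ _)).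
  apply: le_trans (ler_wpM2l L0 m); rewrite [leRHS]mulrA.
  by rewrite ler_wpM2r ?gauss_kernel_ge0.
have [E|ne] := eqVneq (h x - h y) 0.
  rewrite E mul0r normr0 !mulr_ge0 ?expR_ge0 ?sqrtr_ge0 ?gauss_kernel_ge0//.
apply: (le_trans hh).
have e : expR (- ((x - y) ^+ 2 / 16)) <= expR (K ^+ 2 / 16) * gwindow p y.
  rewrite /gwindow -expRD ler_expR.
  have [yK|yK] := leP `|y - p| (2 * K).
    have : (y - p) ^+ 2 <= (2 * K) ^+ 2.
      by rewrite -[(y - p) ^+ 2]real_normK ?num_real// lerXn2r ?nnegrE ?mulr_ge0.
    have := sqr_ge0 (x - y); nra.
  have hy : h y = 0 by apply: hK; move: yK; lra.
  have xK : `|x - p| < K.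
    rewrite ltNge; apply/negP => /hK hx; move: ne.
    by rewrite hx hy subrr eqxx.
  have : `|y - p| / 2 <= `|x - y|.
    by have := ler_distD x y p; rewrite [`|y - x|]distrC; lra.
  move=> d; have : (`|y - p| / 2) ^+ 2 <= `|x - y| ^+ 2.
    by rewrite lerXn2r ?nnegrE ?divr_ge0.
  rewrite expr_div_n !real_normK ?num_real//; have := sqr_ge0 K; nra.
rewrite [leRHS](_ : _ = L * (4 * Num.sqrt t *
  (G (2 * t) (x - y) * (expR (K ^+ 2 / 16) * gwindow p y)))); last by ring.
rewrite ler_wpM2l// ler_wpM2l ?mulr_ge0 ?sqrtr_ge0//.
by rewrite ler_wpM2l ?gauss_kernel_ge0.
Qed.

Lemma lipschitz_window (y : R) : `|h y| <= 3 * L * K * expR (K ^+ 2 / 16) * gwindow p y.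
Proof.
have Kp := K0; have Lp := L0; have [yK|/hK ->] := ltP `|y - p| K; last first.
  by rewrite normr0 !mulr_ge0 ?expR_ge0.
have z : h (p + K) = 0 by apply: hK; rewrite [p + K]addrC addrK ger0_norm.
have h1 : `|h y| <= 3 * L * K.
  have := hL y (p + K); rewrite z subr0 => /le_trans; apply.
  rewrite mulrAC mulrC ler_wpM2r//.
  have := ler_normB (y - p) K; rewrite (ger0_norm K0) opprD addrA; lra.
have h2 : 1 <= expR (K ^+ 2 / 16) * gwindow p y.
  rewrite /gwindow -expRD -[leLHS]expR0 ler_expR.
  have : (y - p) ^+ 2 <= K ^+ 2.
    by rewrite -[(y - p) ^+ 2]real_normK ?num_real//; apply: lerXn2r; rewrite ?nnegrE//; exact: ltW.
  have := sqr_ge0 K; lra.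
rewrite -mulrA -[leLHS]mulr1; apply: ler_pM => //.
Qed.

Lemma lipschitz_continuous_fun : continuous h.
Proof.
move=> x; apply/cvgrPdist_le => e e0.
have L1 : 0 < L + 1 by rewrite ltr_wpDl.
exists (e / (L + 1)) => /=; first by rewrite divr_gt0.
move=> y /ltW; rewrite /ball_ /= ler_pdivlMr// => d.
apply: (le_trans (hL x y)); apply: le_trans d.
by rewrite mulrC ler_wpM2l// lerDl.
Qed.

(** A bound uniform in [y] could not be integrated against an infinite measure; the window makes it
    integrable. *)
Lemma lipschitz_gauss_conv (t y : R) : 0 < t -> t <= 1 ->
  leb.-integrable setT (fun x => (h x * G t (x - y))%:E) /\
  `|\int[leb]_x (h x * G t (x - y)) - h y| <=
    4 * L * expR (K ^+ 2 / 16) * Num.sqrt t * gwindow p y.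
Proof.
move=> t0 t1; have t20 : 0 < 2 * t by rewrite mulr_gt0.
set c := 4 * L * _ * _ * _.
have c0 : 0 <= c by rewrite !mulr_ge0 ?expR_ge0 ?sqrtr_ge0.
have mG s : measurable_fun setT (fun x : TR => G s (x - y)).
  by apply: (measurableT_comp (measurable_gauss_kernel s)); exact: measurable_funB.
have mh : measurable_fun setT (h : TR -> R).
  exact: continuous_measurable_fun lipschitz_continuous_fun.
have i1 := integrable_gauss_kernel y t20.
have i1c : leb.-integrable setT (fun x => (c * G (2 * t) (x - y))%:E).
  by under eq_fun do rewrite EFinM; exact: integrableZl.
have i0 := integrable_gauss_kernel y t0.
have i0c : leb.-integrable setT (fun x => (h y * G t (x - y))%:E).
  by under eq_fun do rewrite EFinM; exact: integrableZl.
have i2 : leb.-integrable setT (fun x => ((h x - h y) * G t (x - y))%:E).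
  apply: (le_integrable measurableT _ _ i1c).
    apply/measurable_EFinP; apply: measurable_funM; last exact: mG.
    exact: measurable_funB.
  move=> x _ /=; rewrite lee_fin; apply: (le_trans (lipschitz_gauss_pointwise x y t0 t1)).
  by rewrite -/c ler_norm.
have E : (fun x => (h x * G t (x - y))%:E) =
    (fun x => ((h x - h y) * G t (x - y) + h y * G t (x - y))%:E).
  by apply/funext => x; congr (_%:E); ring.
split; first by rewrite E; under eq_fun do rewrite EFinD; exact: integrableD.
have -> : \int[leb]_x (h x * G t (x - y)) =
    \int[leb]_x ((h x - h y) * G t (x - y)) + h y.
  have Ey : \int[leb]_x (h y * G t (x - y)) = h y.
    rewrite RintegralZl// [X in _ * X](_ : _ = 1) ?mulr1//.
    by rewrite /Rintegral integral_gauss_kernel.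
  rewrite -[X in _ + X]Ey -RintegralD//.
  by apply: eq_Rintegral => x _; ring.
rewrite addrK; apply: (le_trans (le_normr_Rintegral measurableT i2)).
apply: (@le_trans _ _ (\int[leb]_x (c * G (2 * t) (x - y)))).
  apply: le_Rintegral => //; first exact: integrable_norm i2.
  by move=> x _; exact: lipschitz_gauss_pointwise.
rewrite RintegralZl// [X in _ * X](_ : _ = 1) ?mulr1//.
by rewrite /Rintegral integral_gauss_kernel.
Qed.

End Lipschitz.
End Gauss.

Lemma sigma_finite_pack d (T : measurableType d) (R : realType)
    (mu : {measure set T -> \bar R}) : sigma_finite setT mu ->
  exists m : {sigma_finite_measure set T -> \bar R}, forall A, m A = mu A.
Proof.
move=> sf.
pose H1 := isSFinite.Build _ _ _ _ (sfinite_measure_sigma_finite sf).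
pose H2 := isSigmaFinite.Build _ _ _ _ sf.
by exists (HB.pack_for (SigmaFiniteMeasure.type T R) (Measure.sort mu) H1 H2).
Qed.

(** * The convolutions of the measure with Gaussian kernels *)

Section Smoothing.
Variables (R : realType).
Local Notation TR := (measurableTypeR R).
Local Notation G := (@gauss_kernel R).
Variable mu : {measure set (measurableTypeR R) -> \bar R}.
Hypothesis wb : weakly_bell_shaped mu.

Definition smoothing (t x : R) : R := fine (gauss_conv mu t x).
Local Notation fc := smoothing.

Lemma smoothing_bell_shaped (t : R) : 0 < t -> bell_shaped (fc t).
Proof. by move=> /wb[]. Qed.

Lemma gauss_kernel_mu_integrable (t x : R) : 0 < t ->
  mu.-integrable setT (fun y => (G t (x - y))%:E).
Proof.
move=> /wb[+ _] => /(_ x) h; apply/integrableP; split.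
  apply/measurable_EFinP; apply: (measurableT_comp (measurable_gauss_kernel t)).
  exact: measurable_funB.
under eq_integral do rewrite gee0_abs ?lee_fin ?gauss_kernel_ge0//.
exact: h.
Qed.

Lemma smoothingE (t x : R) : 0 < t -> (fc t x)%:E = gauss_conv mu t x.
Proof.
by move=> t0; rewrite /fc fineK//; exact: integrable_fin_num (gauss_kernel_mu_integrable x t0).
Qed.

(** On [[- N, N]] the kernel [G_1] is at least [G_1 N > 0], and the convolution with [G_1] is finite
    at 0, so bounded intervals have finite measure. *)
Lemma sigma_finite_mu : exists m : {sigma_finite_measure set TR -> \bar R},
  forall A, m A = mu A.
Proof.
apply: sigma_finite_pack.
  exists (fun n => `[- n%:R, n%:R]%classic).
    apply/seteqP; split => // x _.
    exists (Num.truncn `|x|).+1 => //=; rewrite in_itv /= -ler_norml.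
    by rewrite ltW// truncnS_gt.
  move=> n; split; first exact: measurable_itv.
  pose N : R := n%:R; rewrite -/N; set A : set TR := `[- N, N]%classic.
  have mA : measurable A by exact: measurable_itv.
  have G0 : 0 < G 1 N by exact: gauss_kernel_gt0.
  have h := (wb ltr01).1 0.
  have : (((G 1 N)%:E * mu A) <= gauss_conv mu 1 0)%E.
    rewrite -integral_cst; last by [].
    apply: (@le_trans _ _ (\int[mu]_(y in A) (G 1 (0 - y))%:E)%E).
      apply: ge0_le_integral => //=.
      - by move=> y _; rewrite lee_fin gauss_kernel_ge0.
      - apply/measurable_EFinP; apply: measurable_funTS.
        apply: (measurableT_comp (measurable_gauss_kernel 1)).
        exact: measurable_funB.
      move=> y; rewrite /A /= in_itv /= => /andP[y1 y2]; rewrite lee_fin.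
      rewrite /gauss_kernel ler_wpM2l ?invr_ge0// ler_expR lerN2 ler_wpM2r//.
      have : `|0 - y| <= N by rewrite sub0r normrN ler_norml y1.
      by move=> yn; rewrite -[(0 - y) ^+ 2]real_normK ?num_real// lerXn2r ?nnegrE.
    apply: ge0_subset_integral => //=.
    - apply/measurable_EFinP; apply: (measurableT_comp (measurable_gauss_kernel 1)).
      exact: measurable_funB.
    - by move=> y _; rewrite lee_fin gauss_kernel_ge0.
  move=> /le_lt_trans /(_ h); have [->|] := eqVneq (mu A) +oo%E; last by move=> ne _; rewrite ltey.
  by rewrite gt0_muley ?lte_fin.
Qed.

End Smoothing.

Section SmoothingFubini.
Variables (R : realType).
Local Notation TR := (measurableTypeR R).
Local Notation leb := (@lebesgue_measure R).
Local Notation G := (@gauss_kernel R).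

Lemma compact_support_integral (k : R -> R) (a b : R) : continuous k ->
  (forall x, ~~ (a <= x <= b) -> k x = 0) ->
  leb.-integrable setT (fun x => (k x)%:E) /\ \int[leb]_x k x = rint a b k.
Proof.
move=> ck k0.
pose A : set TR := `[a, b]%classic.
have mA : measurable A by exact: measurable_itv.
have kE : k = k \_ A.
  apply/funext => x; rewrite /patch; case: ifPn => // xA; apply: k0.
  by apply: contra xA => xab; rewrite inE /A /= in_itv.
have iA := rint_integrable a b ck; split; last first.
  by rewrite /rint [RHS]Rintegral_mkcond -kE.
rewrite (_ : (fun x => _) = (fun x => (k x)%:E) \_ A).
  by apply/(integrable_restrict _ mA) => //; rewrite setTI.
apply/funext => x; rewrite [in LHS]kE /patch; by case: ifP.
Qed.

Variable mu : {measure set (measurableTypeR R) -> \bar R}.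
Hypothesis wb : weakly_bell_shaped mu.
Local Notation fc := (smoothing mu).

Lemma gwindow_integrable (p : R) : mu.-integrable setT (fun y => (gwindow p y)%:E).
Proof.
under eq_fun do rewrite gwindowE EFinM.
by apply: integrableZl => //; exact: gauss_kernel_mu_integrable.
Qed.

Lemma integral_gwindow (p : R) :
  \int[mu]_y gwindow p y = Num.sqrt (4 * pi * 16) * fc 16 p.
Proof.
under eq_Rintegral do rewrite gwindowE.
by rewrite RintegralZl//; exact: gauss_kernel_mu_integrable.
Qed.

Section Key.
Variables (h : R -> R) (p K L t : R).
Hypothesis K0 : 0 <= K.
Hypothesis L0 : 0 <= L.
Hypothesis hL : forall x y, `|h x - h y| <= L * `|x - y|.
Hypothesis hK : forall x, K <= `|x - p| -> h x = 0.
Hypothesis t0 : 0 < t.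
Hypothesis t1 : t <= 1.

Let ch : continuous h. Proof. exact: lipschitz_continuous_fun L0 hL. Qed.
Let cfc : continuous (fc t).
Proof. by have [sf _ _ _ _] := smoothing_bell_shaped wb t0; exact: (@smooth_continuous R (fc t) 0). Qed.
Let supp x : ~~ (p - K <= x <= p + K) -> h x = 0.
Proof.
move=> hx; apply: hK; rewrite leNgt; apply: contra hx.
by rewrite ltr_norml => /andP[? ?]; apply/andP; split; lra.
Qed.

Let T y := \int[leb]_x (h x * G t (x - y)).

Let mh : measurable_fun setT (h : TR -> R).
Proof. exact: continuous_measurable_fun ch. Qed.

Lemma lipschitz_mu_integrable : mu.-integrable setT (fun y => (h y)%:E).
Proof.
have i := gwindow_integrable p.
have i' := integrableZl measurableT (3 * L * K * expR (K ^+ 2 / 16)) i.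
apply: (le_integrable measurableT _ _ i').
  exact/measurable_EFinP.
move=> y _ /=; rewrite lee_fin.
apply: (le_trans (lipschitz_window K0 L0 hL hK y)); exact: ler_norm.
Qed.

Lemma lipschitz_mu_integral_le :
  `|\int[mu]_y h y| <= 3 * L * K * expR (K ^+ 2 / 16) * (Num.sqrt (4 * pi * 16) * fc 16 p).
Proof.
apply: (le_trans (le_normr_Rintegral measurableT lipschitz_mu_integrable)).
rewrite -integral_gwindow -RintegralZl//; last exact: gwindow_integrable.
apply: le_Rintegral => //.
- exact: integrable_norm lipschitz_mu_integrable.
- exact: (integrableZl measurableT (3 * L * K * expR (K ^+ 2 / 16)) (gwindow_integrable p)).
- by move=> y _; exact: lipschitz_window.
Qed.

(** The convolution is moved from [mu] to [h]. Fubini applies because [|h| (mu * G_t)] is continuous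
    with compact support. *)
Lemma smoothing_fubini :
  mu.-integrable setT (fun y => (T y)%:E) /\
  rint (p - K) (p + K) (fun x => h x * fc t x) = \int[mu]_y T y.
Proof.
have [m mE] := sigma_finite_mu wb.
pose F (z : TR * TR) : \bar R := (h z.1 * G t (z.1 - z.2))%:E.
have mF : measurable_fun setT F.
  apply/measurable_EFinP; apply: measurable_funM; last exact: measurable_gauss_kernel2.
  by apply: (measurableT_comp mh); exact: measurable_fst.
have int_mE (g : TR -> \bar R) : (\int[m]_y g y = \int[mu]_y g y)%E.
  by apply: eq_measure_integral => A _ _; exact: mE.
have iG x := gauss_kernel_mu_integrable wb x t0.
have E1 x : (\int[m]_y F (x, y) = (h x * fc t x)%:E)%E.
  rewrite int_mE /F /=; under eq_integral do rewrite EFinM.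
  by rewrite integralZl// EFinM smoothingE.
have E1a x : (\int[m]_y `|F (x, y)| = (`|h x| * fc t x)%:E)%E.
  rewrite int_mE /F /=; under eq_integral do rewrite normrM (ger0_norm (gauss_kernel_ge0 _ _)) EFinM.
  by rewrite integralZl// EFinM smoothingE.
have E2 y : (\int[leb]_x F (x, y) = (T y)%:E)%E.
  rewrite /T /Rintegral fineK//.
  exact: integrable_fin_num ((lipschitz_gauss_conv K0 L0 hL hK y t0 t1).1).
have s1 x : ~~ (p - K <= x <= p + K) -> h x * fc t x = 0 by move=> /supp ->; rewrite mul0r.
have s2 x : ~~ (p - K <= x <= p + K) -> `|h x| * fc t x = 0.
  by move=> /supp ->; rewrite normr0 mul0r.
have [i1 e1] := @compact_support_integral (fun x => h x * fc t x) (p - K) (p + K)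
  (continuous_mul ch cfc) s1.
have cnh : continuous (fun x => `|h x|) by move=> x; apply: cvg_norm; exact: ch.
have [i2 _] := @compact_support_integral (fun x => `|h x| * fc t x) (p - K) (p + K)
  (continuous_mul cnh cfc) s2.
have iF : (leb \x m)%E.-integrable setT F.
  apply/(integrable12ltyP leb m mF); under eq_integral do rewrite E1a.
  rewrite ltey_eq; apply/orP; left; exact: integrable_fin_num i2.
have mT : measurable_fun setT (fun y : TR => (T y)%:E).
  have := measurable_fubini_G iF.
  by rewrite /fubini_G; under eq_fun do rewrite E2.
split.
  pose c := 4 * L * expR (K ^+ 2 / 16) * Num.sqrt t.
  have j1 := integrableZl measurableT c (gwindow_integrable p).
  have j2 := integrableD measurableT j1 (integrable_norm lipschitz_mu_integrable).
  apply: (le_integrable measurableT mT _ j2) => y _ /=.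
  rewrite lee_fin; have := (lipschitz_gauss_conv K0 L0 hL hK y t0 t1).2.
  rewrite -/(T y) -/c => d.
  have : `|T y| <= c * gwindow p y + `|h y|.
    by rewrite -[T y](subrK (h y)); apply: (le_trans (ler_normD _ _)); rewrite lerD2r.
  by move=> /le_trans; apply; exact: ler_norm.
rewrite -e1 /Rintegral; congr fine.
transitivity (\int[leb]_x \int[m]_y F (x, y))%E.
  by apply: eq_integral => x _; rewrite E1.
by rewrite (Fubini iF) int_mE; apply: eq_integral => y _; exact: E2.
Qed.

(** The measure enters the bound only through the fixed value [(mu * G_16) p]; all dependence on [t]
    is in [sqrt t]. *)
Lemma smoothing_approx :
  `|rint (p - K) (p + K) (fun x => h x * fc t x) - \int[mu]_y h y| <=
  4 * L * expR (K ^+ 2 / 16) * Num.sqrt t * (Num.sqrt (4 * pi * 16) * fc 16 p).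
Proof.
have [iT ->] := smoothing_fubini.
have ih := lipschitz_mu_integrable.
rewrite -integral_gwindow -RintegralZl//; last exact: gwindow_integrable.
rewrite -RintegralB//.
have iB : mu.-integrable setT (EFin \o (fun y => T y - h y)).
  rewrite (_ : EFin \o _ = (fun y => ((T y)%:E - (h y)%:E)%E)); first exact: integrableB.
  by apply/funext.
apply: (le_trans (le_normr_Rintegral measurableT iB)).
apply: le_Rintegral => //.
- exact: integrable_norm iB.
- exact: (integrableZl measurableT (4 * L * expR (K ^+ 2 / 16) * Num.sqrt t) (gwindow_integrable p)).
- by move=> y _; exact: (lipschitz_gauss_conv K0 L0 hL hK y t0 t1).2.
Qed.

End Key.
End SmoothingFubini.

(** * Local mass of the convolutions, uniformly in small times *)

Section SmoothingBounds.
Variables (R : realType).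
Local Notation TR := (measurableTypeR R).
Variable mu : {measure set (measurableTypeR R) -> \bar R}.
Hypothesis wb : weakly_bell_shaped mu.
Local Notation fc := (smoothing mu).

Let cfc (t : R) : 0 < t -> continuous (fc t).
Proof.
by move=> t0; have [sf _ _ _ _] := smoothing_bell_shaped wb t0;
  exact: (@smooth_continuous R (fc t) 0).
Qed.

Let fc0 (t x : R) : 0 < t -> 0 <= fc t x.
Proof. by move=> /(smoothing_bell_shaped wb)[]. Qed.

Definition tent (p A x : R) : R := Num.max 0 (Num.min 1 (A - `|x - p|)).

Lemma tent_lipschitz p A x y : `|tent p A x - tent p A y| <= 1 * `|x - y|.
Proof.
have clip (u : R) : [\/ u <= 0 /\ Num.max 0 (Num.min 1 u) = 0,
    0 <= u <= 1 /\ Num.max 0 (Num.min 1 u) = u | 1 <= u /\ Num.max 0 (Num.min 1 u) = 1].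
  have [u0|u0] := leP u 0; first by constructor 1; rewrite max_l// ge_min u0 orbT.
  have [u1|u1] := leP u 1; last by constructor 3; rewrite ?min_l ?(ltW u1)// max_r.
  by constructor 2; rewrite ?min_r// max_r ?(ltW u0).
have : `| `|x - p| - `|y - p| | <= `|x - y|.
  by have := ler_dist_dist (x - p) (y - p); rewrite opprB addrA subrK.
rewrite mul1r /tent ler_norml => /andP[].
move: `|x - p| `|y - p| `|x - y| (clip (A - `|x - p|)) (clip (A - `|y - p|)) (normr_ge0 (x - y)).
move=> a b d [[? ->]|[/andP[? ?] ->]|[? ->]] [[? ->]|[/andP[? ?] ->]|[? ->]] ? ? ?;
  rewrite ler_norml; apply/andP; split; lra.
Qed.

Lemma tent_ge0 p A x : 0 <= tent p A x.
Proof. by rewrite /tent le_max lexx. Qed.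

Lemma tent_le1 p A x : tent p A x <= 1.
Proof. by rewrite /tent ge_max ler01 ge_min lexx. Qed.

Lemma tent_eq1 p A x : `|x - p| <= A - 1 -> tent p A x = 1.
Proof.
move=> h; rewrite /tent min_l; last by move: `|_| h => d h; lra.
by rewrite max_r.
Qed.

Lemma tent_eq0 p A x : A <= `|x - p| -> tent p A x = 0.
Proof.
by move=> h; rewrite /tent max_l// ge_min subr_le0 h orbT.
Qed.

Definition tent_const (A : R) : R :=
  (3 * A + 4) * expR (A ^+ 2 / 16) * Num.sqrt (4 * pi * 16).

Lemma tent_const_ge0 A : 0 <= A -> 0 <= tent_const A.
Proof. by move=> A0; rewrite !mulr_ge0 ?expR_ge0 ?sqrtr_ge0// addr_ge0// mulr_ge0. Qed.

(** A single bell-shaped function, [mu * G_16], dominates the local masses for all [t <= 1]: it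
    gives both their boundedness and, since it tends to 0, their decay in [p]. *)
Lemma smoothing_local_bound (p A t : R) : 1 <= A -> 0 < t -> t <= 1 ->
  rint (p - (A - 1)) (p + (A - 1)) (fc t) <= tent_const A * fc 16 p.
Proof.
move=> A1 t0 t1; have A0 : 0 <= A by lra.
have L := @tent_lipschitz p A; have Z := @tent_eq0 p A.
have h1 := smoothing_approx wb A0 ler01 L Z t0 t1.
have h2 := lipschitz_mu_integral_le wb A0 ler01 L Z.
have ct := lipschitz_continuous_fun ler01 L.
have cc := continuous_mul ct (cfc t0).
apply: (@le_trans _ _ (rint (p - A) (p + A) (fun x => tent p A x * fc t x))).
  apply: (@le_trans _ _ (rint (p - (A - 1)) (p + (A - 1)) (fun x => tent p A x * fc t x))).
    apply: rint_le => //; first exact: cfc.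
    move=> x /andP[x1 x2]; rewrite tent_eq1 ?mul1r// ler_norml; apply/andP; split; lra.
  by apply: rint_sub => //; [move=> x; rewrite mulr_ge0 ?tent_ge0 ?fc0|lra..].
have st : Num.sqrt t <= 1 by rewrite -[leRHS]sqrtr1; exact: ler_wsqrtr.
move: h1 h2; set I := rint _ _ _; set J := \int[mu]_y _.
set E := expR _; set c := Num.sqrt (4 * pi * 16) * _ => h1 h2.
have E0 : 0 <= E by exact: expR_ge0.
have c0 : 0 <= c by rewrite mulr_ge0 ?sqrtr_ge0 ?fc0.
have h3 : 4 * 1 * E * Num.sqrt t * c <= 4 * E * c.
  by rewrite mulr1 ler_wpM2r// -[leRHS]mulr1 ler_wpM2l// mulr_ge0.
have -> : tent_const A * fc 16 p = 3 * 1 * A * E * c + 4 * E * c.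
  by rewrite /tent_const /c /E; ring.
have := le_trans (ler_norm _) h1; have := le_trans (ler_norm _) h2.
lra.
Qed.

(** The measure is not zero, since otherwise its convolutions would be 0 and have no sign change in
    the derivative. So some tent has an integral [I > 0], and [t0] is chosen to make the error of
    [smoothing_approx] at most [I / 2]. *)
Lemma smoothing_local_mass : exists A m0 t0 : R, [/\ 0 < A, 0 < m0, 0 < t0 <= 1 &
  forall t, 0 < t -> t <= t0 -> m0 <= rint (- A) A (fc t)].
Proof.
have tent_int n : mu.-integrable setT (fun y => (tent 0 n.+1%:R y)%:E).
  exact: (lipschitz_mu_integrable wb (ler0n R n.+1) ler01 (@tent_lipschitz 0 n.+1%:R) (@tent_eq0 0 n.+1%:R)).
have [n I0] : exists n : nat, 0 < \int[mu]_y tent 0 n.+1%:R y.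
  apply: contrapT => /forallNP H.
  have mu0 (n : nat) : mu `[- n%:R, n%:R]%classic = 0%E.
    pose A : set TR := `[- n%:R, n%:R]%classic.
    have mA : measurable A by exact: measurable_itv.
    apply/eqP; rewrite eq_le measure_ge0 andbT -/A.
    have -> : mu A = (\int[mu]_y (\1_A y)%:E)%E by rewrite integral_indic// setIT.
    apply: (@le_trans _ _ (\int[mu]_y (tent 0 n.+1%:R y)%:E)%E).
      apply: ge0_le_integral => //=.
      - by apply/measurable_EFinP; exact: measurable_indic.
      - by case/integrableP : (tent_int n).
      - move=> y _; rewrite lee_fin indicE; case: (boolP (y \in A)) => yA /=; last exact: tent_ge0.
        rewrite tent_eq1// subr0 -natr1 addrK.
        by move: yA; rewrite inE /A /= in_itv /= ler_norml.
    rewrite -[leLHS]fineK; last exact: integrable_fin_num (tent_int n).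
    by rewrite lee_fin leNgt; apply/negP; exact: H.
  have muT A : measurable A -> mu A = 0%E.
    move=> mA; apply/eqP; rewrite eq_le measure_ge0 andbT.
    pose B (n : nat) : set TR := A `&` `[- n%:R, n%:R]%classic.
    have mB n : measurable (B n) by apply: measurableI => //; exact: measurable_itv.
    have -> : A = \bigcup_n B n.
      rewrite -setI_bigcupr; apply/esym/setIidl => x _.
      exists (Num.truncn `|x|).+1 => //=; rewrite in_itv /= -ler_norml.
      by rewrite ltW// truncnS_gt.
    have := @measure_sigma_subadditive _ R TR mu _ B mB
      (bigcup_measurable (fun n _ => mB n)) (@subset_refl _ _).
    move/le_trans; apply; rewrite eseries0// => n _ _.
    apply/eqP; rewrite eq_le measure_ge0 andbT -(mu0 n).
    have sB : B n `<=` (`[- n%:R, n%:R]%classic : set TR) by move=> ? [].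
    have mI : measurable (`[- n%:R, n%:R]%classic : set TR) by exact: measurable_itv.
    exact: (@le_measure _ _ _ mu _ _ (mem_set (mB n)) (mem_set mI) sB).
  have fz : fc 1 = cst 0.
    apply/funext => x; rewrite /smoothing /gauss_conv.
    rewrite (eq_measure_integral mzero) ?integral_measure_zero// => A mA _.
    exact: muT.
  have [_ _ _ _ fn] := smoothing_bell_shaped wb ltr01.
  have [[s1 [ss1 _ alt]] _] := fn 1%N.
  case: s1 ss1 alt => // x0 [|x1 []]// _ /= /andP[+ _].
  by rewrite fz derive1_cst mul0r ltxx.
set A : R := n.+1%:R in I0.
have A0 : 0 <= A by exact: ler0n.
set I := \int[mu]_y _ in I0.
pose c := 4 * 1 * expR (A ^+ 2 / 16) * (Num.sqrt (4 * pi * 16) * fc 16 0).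
have c0 : 0 <= c by rewrite !mulr_ge0 ?expR_ge0 ?sqrtr_ge0 ?fc0.
pose d := I / (2 * (c + 1)).
have c1 : 0 < 2 * (c + 1) by rewrite mulr_gt0// ltr_wpDl.
have d0 : 0 < d by rewrite divr_gt0.
exists A, (I / 2), (Num.min 1 (d ^+ 2)); split.
- by rewrite ltr0n.
- by rewrite divr_gt0.
- by rewrite lt_min ltr01 exprn_gt0//= ge_min lexx.
move=> t t0; rewrite le_min => /andP[t1 td].
have L := @tent_lipschitz 0 A; have Z := @tent_eq0 0 A.
have ct := lipschitz_continuous_fun ler01 L.
have cc := continuous_mul ct (cfc t0).
have h1 := smoothing_approx wb A0 ler01 L Z t0 t1.
rewrite sub0r add0r in h1.
have st : Num.sqrt t <= d.
  by rewrite -[leRHS]ger0_norm ?(ltW d0)// -sqrtr_sqr; exact: ler_wsqrtr.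
have h2 : 4 * 1 * expR (A ^+ 2 / 16) * Num.sqrt t * (Num.sqrt (4 * pi * 16) * fc 16 0) <= I / 2.
  rewrite (_ : _ * _ * _ = c * Num.sqrt t); last by rewrite /c; ring.
  apply: (@le_trans _ _ (c * d)); first exact: ler_wpM2l.
  rewrite /d mulrA ler_pdivrMr// (_ : I / 2 * _ = (c + 1) * I); last by field.
  by apply: ler_wpM2r; [exact: ltW|rewrite lerDl].
have := le_trans h1 h2; rewrite -/I ler_norml => /andP[h3 _].
apply: (@le_trans _ _ (rint (- A) A (fun x => tent 0 A x * fc t x))); first by lra.
apply: rint_le => //; first exact: cfc.
by move=> x _; rewrite -[leRHS]mul1r ler_wpM2r ?fc0// tent_le1.
Qed.

End SmoothingBounds.

(** * Test functions and distributional derivatives *)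

Section TestFunctions.
Variables (R : realType).
Implicit Types (phi g : R -> R) (U : set R).

Lemma smooth_vanish_off phi (K : R) : (forall x, K < `|x| -> phi x = 0) ->
  forall (n : nat) x, K < `|x| -> derive1n n phi x = 0.
Proof.
move=> h; elim=> [|n IH] x Kx; first exact: h.
rewrite derive1nS derive1E (near_eq_derive _ (g := cst 0)) ?derive_cst//.
have : \forall y \near x, K < `|y|.
  exact: (@cvgr_gt R R (nbhs x) _ (fun y => `|y|) `|x| (cvg_norm (@cvg_id _ (nbhs x))) K Kx).
by apply: filterS => y; exact: IH.
Qed.

Lemma test_function_support U phi : test_function U phi -> exists2 K : R, 0 <= K &
  forall (n : nat) x, K <= `|x| -> derive1n n phi x = 0.
Proof.
move=> [_ cpt _]; have [M [_ hM]] := compact_bounded cpt.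
have M1 : M < `|M| + 1 by rewrite ltr_pwDr// ler_norm.
exists (`|M| + 2); first by rewrite addr_ge0.
move=> n x Kx; apply: (@smooth_vanish_off phi (`|M| + 1)); last first.
  by apply: lt_le_trans Kx; rewrite ltrD2l ltr1n.
move=> y My; apply/eqP; apply: contraTT My => py; rewrite -leNgt.
exact: hM M1 y (@subset_closure _ _ y py).
Qed.

Lemma smooth_support_lipschitz phi (K : R) (n : nat) : 0 <= K -> smooth phi ->
  (forall (n : nat) x, K <= `|x| -> derive1n n phi x = 0) ->
  exists2 L : R, 0 <= L &
    forall x y, `|derive1n n phi x - derive1n n phi y| <= L * `|x - y|.
Proof.
move=> K0 sphi phiK.
have cn : continuous (fun x => `|derive1n n.+1 phi x|).
  by move=> x; apply: cvg_norm; exact: smooth_continuous.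
have KK : - K <= K by rewrite ge0_cp.
have [c _ hc] := EVT_max KK (continuous_subspaceT cn).
exists `|derive1n n.+1 phi c| => // x y.
have bound z : `|derive1n n.+1 phi z| <= `|derive1n n.+1 phi c|.
  have [zK|Kz] := leP `|z| K; last by rewrite phiK ?(ltW Kz)// normr0.
  by apply: hc; rewrite in_itv /= -ler_norml.
wlog yx : x y / y <= x.
  move=> W; have [|/ltW] := leP y x; first exact: W.
  by move=> /W; rewrite distrC [`|x - y|]distrC.
have [z _ ->] := is_derive_MVT (fun x => smooth_is_derive n x sphi) yx.
by rewrite normrM ler_wpM2r.
Qed.

Lemma test_function_by_parts phi g (K : R) (n : nat) : 0 <= K -> smooth phi -> smooth g ->
  (forall (n : nat) x, K <= `|x| -> derive1n n phi x = 0) ->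
  rint (- K) K (fun x => derive1n n phi x * g x) =
  (-1) ^+ n * rint (- K) K (fun x => phi x * derive1n n g x).
Proof.
move=> K0 sphi sg phiK; have KK : - K <= K by rewrite ge0_cp.
suff H m : rint (- K) K (fun x => derive1n n phi x * derive1n m g x) =
  (-1) ^+ n * rint (- K) K (fun x => phi x * derive1n (n + m) g x).
  by have := H 0%N; rewrite addn0.
elim: n m => [|n IH] m; first by rewrite mul1r.
rewrite (rint_by_parts KK (smooth_continuous sphi) (smooth_continuous sg)
  (fun x => smooth_is_derive n x sphi) (fun x => smooth_is_derive m x sg)).
rewrite !phiK ?normrN ?ler_norm// !mul0r !sub0r IH addSnnS exprS mulN1r mulNr.
by rewrite oppr0 add0r.
Qed.

Variable mu : {measure set (measurableTypeR R) -> \bar R}.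
Hypothesis wb : weakly_bell_shaped mu.

(** All [n] derivatives are moved to [phi]. Then [phi^(n)] is Lipschitz with bounded support, and
    [smoothing_approx] gives the rate. *)
Lemma distr_derive_approx U phi (n : nat) : test_function U phi ->
  exists2 K : R, 0 <= K & exists2 C : R, 0 <= C &
    (forall x, K <= `|x| -> phi x = 0) /\
    forall t, 0 < t -> t <= 1 ->
    `|rint (- K) K (fun x => phi x * derive1n n (smoothing mu t) x) - distr_derive mu n phi|
      <= C * Num.sqrt t.
Proof.
move=> tphi; have [K K0 phiK] := test_function_support tphi.
have [sphi _ _] := tphi.
have [L L0 hL] := smooth_support_lipschitz n K0 sphi phiK.
exists K => //.
pose c := 4 * L * expR (K ^+ 2 / 16) * (Num.sqrt (4 * pi * 16) * smoothing mu 16 0).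
have [_ f0 _ _ _] := @smoothing_bell_shaped R mu wb 16 ltac:(by []).
exists c; first by rewrite !mulr_ge0 ?expR_ge0 ?sqrtr_ge0 ?f0.
split; first exact: (phiK 0%N).
move=> t t0 t1; have [sf _ _ _ _] := smoothing_bell_shaped wb t0.
have Z x : K <= `|x - 0| -> derive1n n phi x = 0 by rewrite subr0; exact: phiK.
have := smoothing_approx wb K0 L0 hL Z t0 t1.
rewrite sub0r add0r (test_function_by_parts n K0 sphi sf phiK) /distr_derive.
rewrite (_ : 4 * L * _ * _ * _ = c * Num.sqrt t); last by rewrite /c; ring.
set I := rint _ _ _; set J := \int[mu]_y _ => h.
rewrite (_ : I - _ = (-1) ^+ n * ((-1) ^+ n * I - J)).
  by rewrite normrM normrX normrN1 expr1n mul1r.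
by rewrite mulrBr mulrA -exprMn mulrNN mulr1 expr1n mul1r.
Qed.

(** If [s (mu * G_t)^(n)] were nonnegative on [U], its integral against [phi] would be nonnegative,
    although it lies within [C sqrt t] of the negative number [s T phi]. *)
Lemma distr_derive_sign U phi (n : nat) (s : R) : test_function U phi ->
  (forall y, 0 <= phi y) -> s = 1 \/ s = -1 -> s * distr_derive mu n phi < 0 ->
  exists2 d : R, 0 < d & forall t, 0 < t -> t <= 1 -> t <= d ->
    ~ (forall x, U x -> 0 <= s * derive1n n (smoothing mu t) x).
Proof.
move=> tphi phi0 sE T0; have [sphi _ phiU] := tphi.
have [K K0 [C C0 [phiK happ]]] := distr_derive_approx n tphi.
set T := distr_derive mu n phi in T0 happ.
have C1 : 0 < C + 1 by rewrite ltr_wpDl.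
pose e := - (s * T) / (C + 1).
have e0 : 0 < e by rewrite divr_gt0// oppr_gt0.
exists (e ^+ 2); first by rewrite exprn_gt0.
move=> t t0 t1 td fU; have := happ t t0 t1; apply/negP; rewrite -ltNge.
have [sf _ _ _ _] := smoothing_bell_shaped wb t0.
have cf := @smooth_continuous R (smoothing mu t) n sf.
have cphi := @smooth_continuous R phi 0 sphi.
set I := rint _ _ _.
have sI : 0 <= s * I.
  rewrite -rintZ; last exact: continuous_mul.
  apply: rint_ge0 => x _; rewrite mulrCA.
  have [->|px] := eqVneq (phi x) 0; first by rewrite mul0r.
  by apply: mulr_ge0 => //; apply: fU; apply: phiU; exact: subset_closure.
have st : Num.sqrt t <= e.
  by rewrite -[leRHS]ger0_norm ?(ltW e0)// -sqrtr_sqr; exact: ler_wsqrtr.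
apply: (@le_lt_trans _ _ (C * e)); first exact: ler_wpM2l.
have eE : e * (C + 1) = - (s * T) by rewrite /e divfK// gt_eqF.
have : - (s * T) <= `|I - T|.
  apply: (@le_trans _ _ (s * (I - T))); first by rewrite mulrBr lerDr.
  apply: le_trans (ler_norm _) _; rewrite normrM.
  by case: sE => ->; rewrite ?normrN1 ?normr1 mul1r.
by apply: lt_le_trans; rewrite -eE mulrC ltr_pM2l// ltrDl.
Qed.

End TestFunctions.

(** * Location of the zeroes *)

Section Main.
Variables (R : realType).

Lemma bell_shaped_sign_change_bound (f : R -> R) : bell_shaped f ->
  exists p q : R, forall n : nat, (1 <= n)%N ->
    forall x : R, changes_sign_at (derive1n n f) x -> p * n%:R <= x /\ x <= q * n%:R.
Proof.
move=> bf; have [sf f0 _ _ _] := bf; have cf := @smooth_continuous R f 0 sf.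
have [x0 fx0] : exists x, 0 < f x.
  apply: contrapT => /forallNP fle; have [_ _ _ _ fn] := bf.
  have [[s1 [ss1 _ alt]] _] := fn 0%N.
  have [[{}s1 [{}ss1 _ {}alt]] _] := fn 1%N.
  case: s1 ss1 alt => // x0 [|x1 []]// _ /= /andP[+ _].
  have -> : f = cst 0.
    by apply/funext => x; apply/eqP; rewrite eq_le f0 leNgt andbT; apply/negP; exact: fle.
  by rewrite derive1_cst mul0r ltxx.
have e0 : 0 < f x0 / 2 by rewrite divr_gt0.
have [d /= d0 hd] := (cvgrPdist_lt _ _).1 (cf x0) _ e0.
pose r1 : R := `|x0| + d.
have r10 : 0 < r1 by rewrite ltr_wpDl.
(* The mass of the constant [f x0 / 2], which is below [f], over [[x0, x0 + d / 2]]. *)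
pose m0 := f x0 / 2 * d / 2.
have m00 : 0 < m0 by rewrite !divr_gt0// mulr_gt0.
pose F g := g = f.
have Fb g : F g -> bell_shaped g by move=> ->.
have Fm g : F g -> m0 <= rint (- r1) r1 g.
  move=> ->; have [x1 x2] : x0 <= `|x0| /\ - `|x0| <= x0.
    by split; [exact: ler_norm|rewrite lerNl -normrN ler_norm].
  apply: (@le_trans _ _ (rint x0 (x0 + d / 2) f)); last first.
    by apply: rint_sub => //; rewrite /r1; lra.
  rewrite (_ : m0 = f x0 / 2 * (x0 + d / 2 - x0)); last by rewrite /m0; ring.
  apply: rint_lb => //; first by lra.
  move=> x /andP[xl xr].
  have : `|f x0 - f x| < f x0 / 2 by apply: hd => /=; rewrite ltr_norml; apply/andP; split; lra.
  by rewrite ltr_norml => /andP[]; lra.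
have Fe (e : R) : 0 < e -> exists rho, forall g, F g -> forall x, rho <= `|x| -> rint (x - 1) (x + 1) g <= e.
  move=> e1; have e2 : 0 < e / 2 by rewrite divr_gt0.
  have [B1 hB1] := bell_shaped_vanish bf (or_introl erefl) e2.
  have [B2 hB2] := bell_shaped_vanish bf (or_intror erefl) e2.
  exists (Num.max B1 B2 + 1) => _ -> x Bx.
  have M1 : B1 <= Num.max B1 B2 by rewrite le_max lexx.
  have M2 : B2 <= Num.max B1 B2 by rewrite le_max lexx orbT.
  move: M1 M2 Bx; move: (Num.max _ _) => B M1 M2 Bx.
  rewrite (_ : e = e / 2 * ((x + 1) - (x - 1))); last by field.
  apply: rint_ub => //; first by lra.
  move=> y /andP[y1 y2]; apply: le_trans (ler_norm _) _.
  have [xp|xn] := leP 0 x.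
    rewrite ger0_norm// in Bx.
    by have := hB1 y; rewrite mul1r; apply; lra.
  rewrite ltr0_norm// in Bx.
  by have := hB2 (- y); rewrite mulN1r opprK; apply; lra.
have FM (r : R) : 0 <= r -> exists M, forall g, F g -> rint (- r) r g <= M.
  by move=> _; exists (rint (- r) r f) => _ ->.
have [K K0 hK] := uniform_const_sign r10 m00 Fb Fm Fe FM.
exists (- K), K => n n1 x xc; have [hr hl] := hK f n erefl n1.
split; rewrite leNgt; apply/negP => hx.
  have [|y [z [yU zU fy fz]]] := xc [set y | y < - (K * n%:R)].
    by apply: (@open_lt R) => /=; rewrite -mulNr.
  by case: hl => h; [have := h y yU|have := h z zU]; lra.
have [|y [z [yU zU fy fz]]] := xc [set y | K * n%:R < y].
  exact: (@open_gt R).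
by case: hr => h; [have := h y yU|have := h z zU]; lra.
Qed.

Lemma weakly_bell_shaped_sign_change_bound (mu : {measure set (measurableTypeR R) -> \bar R}) :
  weakly_bell_shaped mu ->
  exists p q : R, forall n : nat, (1 <= n)%N ->
    forall x : R, distr_changes_sign_at (distr_derive mu n) x ->
      p * n%:R <= x /\ x <= q * n%:R.
Proof.
move=> wb; have [A [m0 [t0 [A0 m00 /andP[t00 t01] hm]]]] := smoothing_local_mass wb.
pose F (g : R -> R) := exists t, [/\ 0 < t, t <= t0 & g = smoothing mu t].
have Fb g : F g -> bell_shaped g by move=> [t [t1 _ ->]]; exact: smoothing_bell_shaped.
have Fm g : F g -> m0 <= rint (- A) A g by move=> [t [t1 t2 ->]]; exact: hm.
have Fe (e : R) : 0 < e -> exists rho, forall g, F g -> forall x, rho <= `|x| -> rint (x - 1) (x + 1) g <= e.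
  move=> e1.
  have c0 : 0 < tent_const (2 : R) + 1 by rewrite ltr_wpDl// tent_const_ge0.
  have e2 : 0 < e / (tent_const 2 + 1) by rewrite divr_gt0.
  have bf : bell_shaped (smoothing mu 16) by exact: smoothing_bell_shaped.
  have [_ f0 _ _ _] := bf.
  have [B1 hB1] := bell_shaped_vanish bf (or_introl erefl) e2.
  have [B2 hB2] := bell_shaped_vanish bf (or_intror erefl) e2.
  exists (Num.max B1 B2) => _ [t [t1 t2 ->]] x Bx.
  have fx : smoothing mu 16 x <= e / (tent_const 2 + 1).
    apply: le_trans (ler_norm _) _; move: Bx; rewrite ge_max => /andP[Bx1 Bx2].
    have [xp|xn] := leP 0 x.
      by rewrite ger0_norm// in Bx1; have := hB1 x Bx1; rewrite mul1r.
    by rewrite ltr0_norm// in Bx2; have := hB2 (- x) Bx2; rewrite mulN1r opprK.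
  have := @smoothing_local_bound R mu wb x 2 t ltac:(by rewrite ler1n) t1 (le_trans t2 t01).
  rewrite (_ : 2 - 1 = 1 :> R); last by ring.
  move/le_trans; apply; apply: (@le_trans _ _ ((tent_const 2 + 1) * (e / (tent_const 2 + 1)))).
    by apply: ler_pM => //; [exact: tent_const_ge0|rewrite lerDl].
  by rewrite mulrC divfK// gt_eqF.
have FM (r : R) : 0 <= r -> exists M, forall g, F g -> rint (- r) r g <= M.
  move=> r0; exists (tent_const (r + 1) * smoothing mu 16 0) => _ [t [t1 t2 ->]].
  have := @smoothing_local_bound R mu wb 0 (r + 1) t ltac:(by rewrite lerDr) t1 (le_trans t2 t01).
  by rewrite addrK sub0r add0r.
have [K K0 hK] := uniform_const_sign A0 m00 Fb Fm Fe FM.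
have key n x (U : set R) : (1 <= n)%N -> nbhs x U -> distr_changes_sign_at (distr_derive mu n) x ->
    ~ (forall t, 0 < t -> t <= t0 -> (forall x, U x -> 0 <= derive1n n (smoothing mu t) x) \/
    (forall x, U x -> derive1n n (smoothing mu t) x <= 0)).
  move=> n1 xU xc H; have [phi [psi [[tphi phi0] [tpsi psi0] Tphi Tpsi]]] := xc U xU.
  have [d1 d10 h1] := @distr_derive_sign R mu wb U phi n 1 tphi phi0 (or_introl erefl)
    ltac:(by rewrite mul1r).
  have [d2 d20 h2] := @distr_derive_sign R mu wb U psi n (-1) tpsi psi0 (or_intror erefl)
    ltac:(by rewrite mulN1r oppr_lt0).
  (* One time must serve both test functions: whichever sign [(mu * G_t)^(n)] has on [U], one of the
     two is contradicted. *)
  pose t := Num.min t0 (Num.min d1 d2).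
  have tp : 0 < t by rewrite !lt_min t00 d10.
  have [tt0 td1 td2] : [/\ t <= t0, t <= d1 & t <= d2] by rewrite /t !ge_min !lexx !orbT.
  have tt1 := le_trans tt0 t01.
  case: (H t tp tt0) => h.
    by apply: (h1 t tp tt1 td1) => y yU; rewrite mul1r; exact: h.
  by apply: (h2 t tp tt1 td2) => y yU; rewrite mulN1r oppr_ge0; exact: h.
have Ft t : 0 < t -> t <= t0 -> F (smoothing mu t) by exists t.
exists (- K), K => n n1 x xc.
split; rewrite leNgt; apply/negP => hx.
  apply: (key n x [set y | y < - (K * n%:R)] n1 _ xc).
    by apply: (@open_lt R) => /=; rewrite -mulNr.
  by move=> t t1 t2; exact: (hK _ n (Ft t t1 t2) n1).2.
apply: (key n x [set y | K * n%:R < y] n1 _ xc).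
  exact: (@open_gt R).
by move=> t t1 t2; exact: (hK _ n (Ft t t1 t2) n1).1.
Qed.

End Main.

Unset Implicit Arguments.
Set Strict Implicit.

Theorem corollary1p6 (R : realType) :
  (forall f : R -> R, bell_shaped f ->
    exists p q : R, forall n : nat, (1 <= n)%N ->
      forall x : R, changes_sign_at (derive1n n f) x ->
        p * n%:R <= x /\ x <= q * n%:R) /\
  (forall mu : {measure set (measurableTypeR R) -> \bar R},
    weakly_bell_shaped mu ->
    exists p q : R, forall n : nat, (1 <= n)%N ->
      forall x : R, distr_changes_sign_at (distr_derive mu n) x ->
        p * n%:R <= x /\ x <= q * n%:R).
Proof.
split; first exact: bell_shaped_sign_change_bound.
exact: weakly_bell_shaped_sign_change_bound.
Qed.
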